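(* The dimension of the basic cohomology $\widetilde{H}^q(\widetilde{\mathcal{SV}},\mathbb{C})$ of the extended Schrödinger-Virasoro conformal algebra with trivial coefficients ($q\in\mathbb{Z}_+$) is $$\dim \widetilde{H}^q(\widetilde{\mathcal{SV}},\mathbb{C})=\begin{cases}1 & \text{if } q=0,\\ 3 & \text{if } q=3,\\ 2 & \text{if } q=4,\\ 0 & \text{otherwise.}\end{cases}$$ In particular, $$\widetilde{H}^q(\widetilde{\mathcal{SV}},\mathbb{C})=\begin{cases}\mathbb{C} & \text{if } q=0,\\ \mathbb{C}\Phi^1\oplus\mathbb{C}\Phi^2\oplus\mathbb{C}\Phi^3 & \text{if } q=3,\\ \mathbb{C}\Psi^1\oplus\mathbb{C}\Psi^2 & \text{if } q=4,\\ 0 & \text{otherwise,}\end{cases}$$ where $\Phi^1,\Phi^2,\Phi^3$ (resp. $\Psi^1,\Psi^2$) denote the cohomology classes of the $3$-cocycles (resp. $4$-cocycles) determined by $$\Phi^1_{\lambda_1,\lambda_2,\lambda_3}(L,N,N)=\lambda_2-\lambda_3,$$ $$\Phi^2_{\lambda_1,\lambda_2,\lambda_3}(L,L,N)=(\lambda_1-\lambda_2)\lambda_3,$$ $$\Phi^3_{\lambda_1,\lambda_2,\lambda_3}(L,L,L)=(\lambda_1-\lambda_2)(\lambda_1-\lambda_3)(\lambda_2-\lambda_3),$$ $$\Psi^1_{\lambda_1,\lambda_2,\lambda_3,\lambda_4}(L,L,N,N)=(\lambda_1-\lambda_2)(\lambda_3-\lambda_4),$$ $$\Psi^2_{\lam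bda_1,\lambda_2,\lambda_3,\lambda_4}(L,L,L,N)=(\lambda_1-\lambda_2)(\lambda_1-\lambda_3)(\lambda_2-\lambda_3).$$
   Context: All vector spaces are over $\mathbb{C}$; $\mathbb{Z}_+$ is the set of nonnegative integers. Lie conformal algebra: a $\mathbb{C}[\partial]$-module $\mathcal{A}$ with a $\mathbb{C}$-bilinear map $\mathcal{A}\otimes\mathcal{A}\to\mathbb{C}[\lambda]\otimes\mathcal{A}$, $a\otimes b\mapsto[a_\lambda b]$, satisfying $[\partial a_\lambda b]=-\lambda[a_\lambda b]$, $[a_\lambda\partial b]=(\partial+\lambda)[a_\lambda b]$, $[a_\lambda b]=-[b_{-\lambda-\partial}a]$, and $[a_\lambda[b_\mu c]]=[[a_\lambda b]_{\lambda+\mu}c]+[b_\mu[a_\lambda c]]$. The extended Schrödinger-Virasoro conformal algebra $\widetilde{\mathcal{SV}}$ is the Lie conformal algebra that is the free $\mathbb{C}[\partial]$-module on $L,N,Y,M$ with $[L_\lambda L]=(\partial+2\lambda)L$, $[L_\lambda Y]=(\partial+\frac32\lambda)Y$, $[L_\lambda M]=(\partial+\lambda)M$, $[L_\lambda N]=(\partial+\lambda)N$, $[Y_\lambda Y]=(\partial+2\lambda)M$, $[N_\lambda Y]=Y$, $[N_\lambda M]=2M$; the brackets in the opposite order are determined by skew-symmetry, and all other brackets of generators are zero. Basic cohomology with trivial coefficients $\mathbb{C}$ (on which $\partial$ and all $a_\lambda$ act as zero): an $n$-cochain is a $\mathbb{C}$-linear map $\gamma:\mathcal{A}^{\otimes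 n}\to\mathbb{C}[\lambda_1,\dots,\lambda_n]$, $a_1\otimes\cdots\otimes a_n\mapsto\gamma_{\lambda_1,\dots,\lambda_n}(a_1,\dots,a_n)$, such that (1) $\gamma_{\lambda_1,\dots,\lambda_n}(a_1,\dots,\partial a_i,\dots,a_n)=-\lambda_i\gamma_{\lambda_1,\dots,\lambda_n}(a_1,\dots,a_n)$, and (2) $\gamma$ is skew-symmetric under simultaneous permutations of the $a_i$'s and the $\lambda_i$'s. The space of $n$-cochains is $\widetilde{C}^n(\mathcal{A},\mathbb{C})$, with $\widetilde{C}^0(\mathcal{A},\mathbb{C})=\mathbb{C}$. The differential is $d_0=0$ and, for $n\ge1$, $$(d_n\gamma)_{\lambda_1,\dots,\lambda_{n+1}}(a_1,\dots,a_{n+1})=\sum_{1\le i<j\le n+1}(-1)^{i+j}\gamma_{\lambda_i+\lambda_j,\lambda_1,\dots,\hat{\lambda_i},\dots,\hat{\lambda_j},\dots,\lambda_{n+1}}([a_{i\,\lambda_i}a_j],a_1,\dots,\hat{a_i},\dots,\hat{a_j},\dots,a_{n+1}),$$ where $\gamma$ is extended linearly over polynomials in the $\lambda_i$. Then $d^2=0$, and $\widetilde{H}^q(\mathcal{A},\mathbb{C})=\ker d_q/\operatorname{im}d_{q-1}$. A cochain on $\widetilde{\mathcal{SV}}$ is determined by its values on the generators $L,N,Y,M$. When a cochain is specified by its value on one tuple of generators, its values on reorderings of that tuple are given by skew-symmetry, and it is zero on all other tuples of generators. *)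

(* Defs.v *)
From HB Require Import structures.
From mathcomp Require Import all_boot all_order all_fingroup all_algebra.
From mathcomp Require Import generic_quotient ring_quotient.
From mathcomp Require Import complex.
From mathcomp Require Export mpoly.
From mathcomp Require Import boolp functions.
From mathcomp Require Export reals.

Set Implicit Arguments.
Unset Strict Implicit.
Unset Printing Implicit Defensive.
Set Warnings "-notation-incompatible-prefix".

Import GRing.Theory.
Local Open Scope ring_scope.
Local Open Scope quotient_scope.

(* Quotient of a vector space by a subspace; [ring_quotient] only provides    *)
(* the underlying additive group.                                             *)
Section QuotientLmodule.
Variables (K : fieldType) (V : lmodType K) (W : {pred V}).
Hypothesis W_submod : submod_closed W.

Definition quot_zmodClosed : zmodClosed V :=
  HB.pack (W : V -> bool)
    (GRing.isZmodClosed.Build V W (GRing.submod_closedB W_submod)).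

Definition quot_lmod : Type := Quotient.quot quot_zmodClosed.
HB.instance Definition _ := GRing.Zmodule.on quot_lmod.

Definition quot_class (x : V) : quot_lmod := \pi_(Quotient.quot quot_zmodClosed) x.

Lemma quot_classD : {morph quot_class : x y / x + y}.
Proof. by move=> x y; rewrite /quot_class raddfD. Qed.

Lemma quot_class_eq x y : (quot_class x = quot_class y) <-> (x - y \in W).
Proof.
have E : (x - y \in W) = (x == y %[mod Quotient.quot quot_zmodClosed]).
  exact: (Quotient.idealrBE quot_zmodClosed).
by rewrite E; split=> [/eqP|/eqP].
Qed.

Lemma quot_classP (x : quot_lmod) : exists v, x = quot_class v.
Proof. by exists (repr (x : Quotient.quot quot_zmodClosed)); rewrite /quot_class reprK. Qed.

Definition quot_scale (c : K) (x : quot_lmod) : quot_lmod :=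
  quot_class (c *: repr (x : Quotient.quot quot_zmodClosed)).

Lemma quot_classZ c x : quot_scale c (quot_class x) = quot_class (c *: x).
Proof.
apply/quot_class_eq; rewrite -scalerBr; apply: (GRing.subsemimod_closedZ W_submod).
by apply/quot_class_eq; rewrite /quot_class reprK.
Qed.

Lemma quot_scalerA a b v : quot_scale a (quot_scale b v) = quot_scale (a * b) v.
Proof. by have [x ->] := quot_classP v; rewrite !quot_classZ scalerA. Qed.

Lemma quot_scale1r : left_id 1 quot_scale.
Proof. by move=> v; have [x ->] := quot_classP v; rewrite quot_classZ scale1r. Qed.

Lemma quot_scalerDr : right_distributive quot_scale +%R.
Proof.
move=> a u v; have [x ->] := quot_classP u; have [y ->] := quot_classP v.
by rewrite -quot_classD !quot_classZ scalerDr quot_classD.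
Qed.

Lemma quot_scalerDl v : {morph quot_scale^~ v : a b / a + b}.
Proof.
move=> a b; have [x ->] := quot_classP v.
by rewrite !quot_classZ scalerDl quot_classD.
Qed.

HB.instance Definition _ := GRing.Zmodule_isLmodule.Build K quot_lmod
  quot_scalerA quot_scale1r quot_scalerDr quot_scalerDl.

End QuotientLmodule.

Definition is_basis (K : fieldType) (V : lmodType K) (n : nat) (b : n.-tuple V) :=
  forall v, exists! c : 'rV[K]_n, v = \sum_(i < n) c 0 i *: tnth b i.

Definition has_dim (K : fieldType) (V : lmodType K) (n : nat) :=
  exists b : n.-tuple V, is_basis b.

(* The free K[∂]-module of rank r is ['rV[{poly K}]_r], with ∂ acting as      *)
(* multiplication by 'X.  Accordingly K[λ] ⊗ 'rV[{poly K}]_r is               *)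
(* ['rV[{poly {poly K}}]_r], where λ is the outer and ∂ the inner variable.   *)
Section BasicComplex.
Variables (K : fieldType) (r : nat).

Local Notation A := 'rV[{poly K}]_r.
Local Notation Alambda := 'rV[{poly {poly K}}]_r.

Definition lambda_coef (v : Alambda) (k : nat) : A :=
  \row_(l < r) (v 0 l)`_k.

Definition lambda_size (v : Alambda) : nat := \max_(l < r) size (v 0%R l).

(* Not necessarily linear; λ_1, ..., λ_n are the variables 'X_0, ..., 'X_(n-1). *)
Definition precochain (n : nat) : Type := {ffun 'I_n -> A} -> {mpoly K[n]}.

HB.instance Definition _ n := GRing.Lmodule.on (precochain n).

Lemma precochainE n c (g h : precochain n) a : (c *: g + h) a = c *: g a + h a.
Proof. by []. Qed.

Definition upd n (a : {ffun 'I_n -> A}) (i : 'I_n) (x : A) : {ffun 'I_n -> A} :=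
  [ffun k => if k == i then x else a k].

Definition multilinear n (g : precochain n) :=
  forall a i (c : K) x y,
    g (upd a i (c%:P *: x + y)) = c *: g (upd a i x) + g (upd a i y).

Definition sesquilinear n (g : precochain n) :=
  forall a i, g (upd a i ('X *: a i)) = - 'X_i * g a.

Definition skew_symmetric n (g : precochain n) :=
  forall (s : 'S_n) (a : {ffun 'I_n -> A}),
    g [ffun k => a (s k)] \mPo [tuple 'X_(s k) | k < n] = (-1) ^+ s * g a.

Definition is_cochain n (g : precochain n) :=
  [/\ multilinear g, sesquilinear g & skew_symmetric g].

Lemma is_cochain0 n : is_cochain (0 : precochain n).
Proof.
split=> [a i c x y|a i|s a].
- by rewrite [LHS](_ : _ = 0) // scaler0 addr0.
- by rewrite mulr0.
- by rewrite [X in X \mPo _](_ : _ = 0) // comp_mpoly0 mulr0.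
Qed.

Lemma is_cochain_linear n c (g h : precochain n) :
  is_cochain g -> is_cochain h -> is_cochain (c *: g + h).
Proof.
move=> [g1 g2 g3] [h1 h2 h3]; split.
- move=> a i e x y; rewrite !precochainE g1 h1.
  by rewrite !scalerDr !scalerA [c * e]mulrC addrACA.
- by move=> a i; rewrite !precochainE g2 h2 scalerAr -mulrDr.
- move=> s a; rewrite !precochainE.
  by rewrite comp_mpolyD comp_mpolyZ g3 h3 scalerAr -mulrDr.
Qed.

(* For i < j, enumerates increasingly the indices other than i and j.         *)
Definition skip2 n (i j : 'I_n.+2) (k : 'I_n) : 'I_n.+2 :=
  lift j (lift (inord i) k).

(* The family x, y_0, ..., y_(n-1).                                           *)
Definition fcons T n (x : T) (y : 'I_n -> T) (k : 'I_n.+1) : T :=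
  oapp y x (unlift ord0 k).

Section Differential.
Variable br : A -> A -> Alambda.

(* The 0-based i + j has the parity of the 1-based one.                       *)
Definition diff (n : nat) : precochain n -> precochain n.+1 :=
  match n with
  | 0 => fun _ _ => 0
  | p.+1 => fun g a =>
    \sum_(i < p.+2) \sum_(j < p.+2 | (i < j)%N)
      (-1) ^+ (i + j) *
      (\sum_(m < lambda_size (br (a i) (a j)))
         'X_i ^+ m *
         (g (finfun (fcons (lambda_coef (br (a i) (a j)) m)
                           (fun l : 'I_p => a (skip2 i j l))))
            \mPo [tuple fcons ('X_i + 'X_j)
                              (fun l : 'I_p => 'X_(skip2 i j l)) k | k < p.+1]))
  end.

Lemma diff_linear n c (g h : precochain n) :
  diff (c *: g + h) = c *: diff g + diff h.
Proof.
apply: funext => a; rewrite precochainE.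
case: n g h a => [|p] g h a /=; first by rewrite scaler0 addr0.
rewrite scaler_sumr -big_split /=.
apply: eq_bigr => i _; rewrite scaler_sumr -big_split /=.
apply: eq_bigr => j _; rewrite scalerAr -mulrDr; congr (_ * _).
rewrite scaler_sumr -big_split /=; apply: eq_bigr => k _.
by rewrite precochainE scalerAr -mulrDr comp_mpolyD comp_mpolyZ.
Qed.

Lemma diff0 n : diff (0 : precochain n) = 0.
Proof. by have := diff_linear (-1) (0 : precochain n) 0; rewrite scaler0 addr0 scaleN1r addNr. Qed.

Definition is_cocycle n : {pred precochain n} :=
  [pred g | `[< is_cochain g /\ diff g = 0 >]].

Definition is_coboundary n : precochain n -> Prop :=
  match n with
  | 0 => fun g => g = 0
  | p.+1 => fun g => exists2 h, is_cochain h & g = diff h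
  end.

Lemma is_cocycle_submod n : submod_closed (@is_cocycle n).
Proof.
split=> [|c g h /asboolP[g1 g2] /asboolP[h1 h2]]; apply/asboolP; split.
- exact: is_cochain0.
- exact: diff0.
- exact: is_cochain_linear.
- by rewrite diff_linear g2 h2 scaler0 addr0.
Qed.

HB.instance Definition _ n :=
  GRing.isSubmodClosed.Build K (precochain n) (@is_cocycle n) (@is_cocycle_submod n).

Definition cocycle (n : nat) : Type := {g : precochain n | g \in @is_cocycle n}.
HB.instance Definition _ n := SubChoice.on (cocycle n).
HB.instance Definition _ n := [SubChoice_isSubLmodule of cocycle n by <:].

Definition coboundary n : {pred cocycle n} :=
  [pred g | `[< is_coboundary (val g) >]].

Lemma coboundary_submod n : submod_closed (@coboundary n).
Proof.
split=> [|c g h /asboolP g1 /asboolP h1]; apply/asboolP; rewrite ?linear0 ?linearP.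
  case: n => [|n] //=; exists 0; first exact: is_cochain0.
  by rewrite diff0.
case: n g h g1 h1 => [|n] g h /=; first by move=> -> ->; rewrite scaler0 addr0.
move=> [g' g1 ->] [h' h1 ->]; exists (c *: g' + h'); first exact: is_cochain_linear.
by rewrite diff_linear.
Qed.

(* ker d_n / im d_(n-1).  When [br] satisfies the axioms of a Lie conformal   *)
(* algebra, d^2 = 0, so that all of im d_(n-1) lies in the space of cocycles. *)
Definition cohomology (n : nat) : lmodType K := quot_lmod (@coboundary_submod n).

Definition coh_class n (g : cocycle n) : cohomology n := quot_class (@coboundary_submod n) g.

End Differential.

(* The cochain g takes the value p on the tuple e_(t_1), ..., e_(t_n) of      *)
(* generators, and vanishes on the tuples that do not reorder it.             *)
Definition determined_by n (g : precochain n) (t : n.-tuple 'I_r) (p : {mpoly K[n]}) :=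
  g [ffun k => delta_mx 0 (tnth t k)] = p /\
  forall u : n.-tuple 'I_r, ~~ perm_eq u t -> g [ffun k => delta_mx 0 (tnth u k)] = 0.

End BasicComplex.

(* λ_i, numbered from 1.                                                      *)
Definition lam (K : fieldType) (n i : nat) : {mpoly K[n.+1]} := 'X_(inord i.-1).
Arguments lam {K n} i.

Section ExtendedSchrodingerVirasoro.
Variable K : fieldType.

Definition gL : 'I_4 := @Ordinal 4 0 isT.
Definition gN : 'I_4 := @Ordinal 4 1 isT.
Definition gY : 'I_4 := @Ordinal 4 2 isT.
Definition gM : 'I_4 := @Ordinal 4 3 isT.

Local Notation "'∂'" := (('X : {poly K})%:P : {poly {poly K}}).
Local Notation "'λ'" := ('X : {poly {poly K}}).

Definition gen (i : 'I_4) : 'rV[{poly {poly K}}]_4 := delta_mx 0 i.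

(* [e_i λ e_j] for i <= j, the generators being ordered as L, N, Y, M.        *)
Definition sv_table (i j : 'I_4) : 'rV[{poly {poly K}}]_4 :=
  if (i, j) == (gL, gL) then (∂ + 2%:R * λ) *: gen gL
  else if (i, j) == (gL, gN) then (∂ + λ) *: gen gN
  else if (i, j) == (gL, gY) then (∂ + (3%:R / 2%:R)%:P%:P * λ) *: gen gY
  else if (i, j) == (gL, gM) then (∂ + λ) *: gen gM
  else if (i, j) == (gN, gY) then gen gY
  else if (i, j) == (gN, gM) then 2%:R *: gen gM
  else if (i, j) == (gY, gY) then (∂ + 2%:R * λ) *: gen gM
  else 0.

(* For i > j, [e_i λ e_j] = - [e_j (-λ-∂) e_i].                               *)
Definition sv_gen (i j : 'I_4) : 'rV[{poly {poly K}}]_4 :=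
  if (i <= j)%N then sv_table i j
  else - map_mx (fun p => p \Po (- λ - ∂)) (sv_table j i).

(* [f(∂)x λ g(∂)y] = f(-λ) g(∂+λ) [x λ y].                                    *)
Definition sv_bracket (a b : 'rV[{poly K}]_4) : 'rV[{poly {poly K}}]_4 :=
  \sum_(i < 4) \sum_(j < 4)
    ((map_poly polyC (a 0 i) \Po (- λ)) *
     (map_poly polyC (b 0 j) \Po (∂ + λ))) *: sv_gen i j.

End ExtendedSchrodingerVirasoro.

(* Main.v *)
Require Import Defs.
From mathcomp Require Import all_boot all_order all_algebra complex.
From HB Require Import structures.
From mathcomp Require Import all_fingroup boolp ring zify.
Import GRing.Theory.
Local Open Scope ring_scope.

Set Implicit Arguments.
Unset Strict Implicit.
Unset Printing Implicit Defensive.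

(** Expand the values of a cochain on generators in divided powers of the
    [lambda_i]: the coefficient at [lambda_1^m_1/m_1! ... lambda_n^m_n/m_n!] of
    the value on [e_(g_1), ..., e_(g_n)] is a number [w ((g_1, m_1), ...,
    (g_n, m_n))].  Conformal skew-symmetry says that [w] is alternating in the
    pairs, and the basic differential becomes the Chevalley-Eilenberg
    differential of the annihilation algebra, the Lie algebra with basis
    [L_m, N_m, Y_m, M_m] for [m >= 0] and
    [[L_m, L_n] = (m - n) L_(m+n-1)], [[L_m, N_n] = - n N_(m+n-1)],
    [[N_m, Y_n] = Y_(m+n)] and so on ([coefs_diff]).  A cochain is determined
    by [w] ([coefs_inj]), and every alternating [w] with bounded exponents
    occurs ([cochain_of_form]).

    In this basis the bracket of two basis elements is a multiple of a basis
    element, and [L_1] and [N_0] act diagonally.  A Lie algebra acts trivially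
    on its cohomology by Cartan's formula ([cartan]); applied to
    [L_1 - 5/2 N_0], this says that contraction with that element, divided by
    the weight, is a primitive of every cocycle of nonzero weight
    ([closed_balanced]).  The multiple 5/2 is large enough to give all [Y_m] and
    [M_m] a weight above 1.  Then [L_0] is the only basis element of negative
    weight, namely -1; as an alternating form vanishes when an argument is
    repeated, what is left in weight zero is, in terms of the dual basis, the
    exterior algebra on [L_1] and [N_0] tensored with the span of 1, [L_0 L_2]
    and [L_0 N_1]: twelve monomials, of degree at most 4 ([balanced_listsP]).

    With [u = L_1], [v = N_0], [a = L_0 L_2] and [b = L_0 N_1], the differential
    sends [u] to a multiple of [a], [v] to a multiple of [b], and [u v] to a
    combination of [a v] and [b u] in which [a v] occurs; it vanishes on
    everything in degrees 3 and 4.  So nothing survives in degrees 1 and 2, the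
    four monomials [a u], [b u], [a v], [b v] of degree 3 are subject to one
    relation, and both [a u v] and [b u v] survive in degree 4
    ([closed_balanced1], [closed_balanced2], [balanced3], [exact_balanced3],
    [balanced4], [closed_balanced3]).  The cocycles of the statement are the
    exterior products for [b v], [b u], [a u] and for [b u v], [a u v]. *)

(** * Alternating forms on a Lie algebra with a monomial basis *)

Lemma fcons0 T n (x : T) (y : 'I_n -> T) : fcons x y ord0 = x.
Proof. by rewrite /fcons unlift_none. Qed.

Lemma fconsS T n (x : T) (y : 'I_n -> T) k : fcons x y (lift ord0 k) = y k.
Proof. by rewrite /fcons liftK. Qed.

Lemma fconsP T n (f g : 'I_n.+1 -> T) :
  f ord0 = g ord0 -> (forall k, f (lift ord0 k) = g (lift ord0 k)) -> f = g.
Proof.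
move=> E0 ES; apply: funext => k.
by case: (unliftP ord0 k) => [j|] ->.
Qed.

Lemma fcons_eta T n (f : 'I_n.+1 -> T) : fcons (f ord0) (f \o lift ord0) = f.
Proof. by apply: fconsP => [|k]; rewrite ?fcons0 ?fconsS. Qed.

Lemma fcons_comp_lift_perm T n (x : T) (y : 'I_n -> T) (s : 'S_n) :
  fcons x (y \o s) = fcons x y \o lift_perm ord0 ord0 s.
Proof.
by apply: fconsP => [|k] /=; rewrite ?lift_perm_id ?lift_perm_lift ?fcons0 ?fconsS.
Qed.

Lemma skip2_lift0 n (i j : 'I_n.+1) (k : 'I_n) :
  skip2 ord0 (lift ord0 j) k = lift ord0 (lift j k) :> 'I_n.+2.
Proof.
apply/val_inj; rewrite /= /bump inordK //=; lia.
Qed.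

Lemma skip2_lift_lift0 n (i j : 'I_n.+2) : (i < j)%N ->
  skip2 (lift ord0 i) (lift ord0 j) ord0 = ord0 :> 'I_n.+3.
Proof.
move=> ij; have := ltn_ord j => hj; apply/val_inj.
by rewrite /= /bump inordK /= /bump; lia.
Qed.

Lemma skip2_lift_liftS n (i j : 'I_n.+2) (k : 'I_n) : (i < j)%N ->
  skip2 (lift ord0 i) (lift ord0 j) (lift ord0 k) = lift ord0 (skip2 i j k).
Proof.
move=> ij; have := ltn_ord j => hj; apply/val_inj.
by rewrite /= /bump !inordK /= /bump; lia.
Qed.

(** The Lie algebra has basis [Z] and bracket [[x, y] = c x y * mul x y]. *)
Section MonomialLie.
Variables (K : comNzRingType) (Z : Type) (c : Z -> Z -> K) (mul : Z -> Z -> Z).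

Definition form n := ('I_n -> Z) -> K.

Definition alternating n (w : form n) :=
  forall (s : 'S_n) z, w (z \o s) = (-1) ^+ s * w z.

Definition delta n : form n -> form n.+1 :=
  match n with
  | 0 => fun _ _ => 0
  | p.+1 => fun w z =>
    \sum_(i < p.+2) \sum_(j < p.+2 | (i < j)%N)
      (-1) ^+ (i + j) * (c (z i) (z j) *
        w (fcons (mul (z i) (z j)) (z \o skip2 i j)))
  end.

Definition contract n (a : Z) (w : form n.+1) : form n := fun z => w (fcons a z).

Definition replace n (z : 'I_n -> Z) (j : 'I_n) (x : Z) : 'I_n -> Z :=
  fun k => if k == j then x else z k.

Definition lie n (a : Z) (w : form n) : form n :=
  fun z => \sum_j c a (z j) * w (replace z j (mul a (z j))).

Lemma alternating_contract n a (w : form n.+1) :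
  alternating w -> alternating (contract a w).
Proof.
move=> w_alt s z; rewrite /contract fcons_comp_lift_perm w_alt.
by rewrite odd_lift_perm addbb addFb.
Qed.

Lemma alternating_lie n a (w : form n) : alternating w -> alternating (lie a w).
Proof.
move=> w_alt s z; rewrite /lie mulr_sumr [RHS](reindex_inj (@perm_inj _ s)) /=.
apply: eq_bigr => j _; rewrite mulrCA -w_alt; congr (_ * w _).
by apply: funext => k; rewrite /replace /= (inj_eq perm_inj).
Qed.

Lemma alternating_tperm n (w : form n) : alternating w ->
  forall z i j, i != j -> w (z \o tperm i j) = - w z.
Proof. by move=> w_alt z i j ij; rewrite w_alt odd_tperm ij mulN1r. Qed.

Lemma alternating_swap n (w : form n.+2) : alternating w ->
  forall a b z, w (fcons a (fcons b z)) = - w (fcons b (fcons a z)).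
Proof.
move=> w_alt a b z.
rewrite -(alternating_tperm w_alt _ (isT : ord0 != lift ord0 ord0 :> 'I_n.+2)).
congr w; apply: fconsP => [|k] /=; first by rewrite tpermL !fconsS !fcons0.
case: (unliftP ord0 k) => [l|] ->; last by rewrite tpermR !fconsS !fcons0.
by rewrite tpermD // !fconsS.
Qed.

(** Moving the front entry to position [j] is a cycle of length [j + 1]. *)
Lemma alternating_insert n (w : form n.+1) : alternating w ->
  forall (z : 'I_n.+1 -> Z) j x,
    w (fcons x (z \o lift j)) = (-1) ^+ j * w (replace z j x).
Proof.
move=> w_alt z j x.
rewrite (_ : fcons _ _ = replace z j x \o lift_perm ord0 j 1).
  by rewrite w_alt odd_lift_perm odd_perm1 addbF signr_odd.
apply: fconsP => [|k] /=.
  by rewrite lift_perm_id /replace eqxx fcons0.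
by rewrite lift_perm_lift perm1 /replace eq_sym (negbTE (neq_lift _ _)) fconsS.
Qed.

(** Cartan's formula: the terms pairing [a] with [z_j] assemble to the Lie
    derivative; in the others [a] can be brought to the front, at the cost of
    one sign. *)
Lemma cartan n a (w : form n.+1) z : alternating w ->
  delta w (fcons a z) = - lie a w z - delta (contract a w) z.
Proof.
move=> w_alt; rewrite /= big_ord_recl; congr (_ + _).
  rewrite /lie -sumrN big_mkcond big_ord_recl ltnn [LHS]add0r; apply: eq_bigr => j _.
  rewrite fcons0 fconsS.
  rewrite (_ : _ \o _ = z \o lift j); last first.
    by apply: funext => k /=; rewrite skip2_lift0 ?fconsS.
  rewrite (alternating_insert w_alt) lift0 add0n exprS.
  by rewrite mulN1r mulNr [c _ _ * _]mulrCA signrMK.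
case: n w z w_alt => [|n] w z w_alt.
  by rewrite big_ord1 big_mkcond big1 ?oppr0 // => j _; rewrite ifF //=; case: j => [[|[]]].
rewrite -sumrN; apply: eq_bigr => i _; rewrite -sumrN.
rewrite big_mkcond big_ord_recl ltn0 [LHS]add0r -big_mkcond /=.
apply: eq_big => // j; rewrite /bump !add1n ltnS => ij.
rewrite !fconsS addSn addnS !exprS !mulN1r opprK -!mulrN; congr (_ * (_ * _)).
rewrite /contract -(alternating_swap w_alt); congr (w (fcons _ _)).
apply: fconsP => [|k] /=; first by rewrite skip2_lift_lift0 // !fcons0.
by rewrite skip2_lift_liftS // !fconsS.
Qed.

Lemma delta_linear n k (w w' : form n) z :
  delta (fun y => k * w y + w' y) z = k * delta w z + delta w' z.
Proof.
case: n w w' z => [|n] w w' z /=; first by rewrite mulr0 addr0.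
rewrite mulr_sumr -big_split; apply: eq_bigr => i _ /=.
rewrite mulr_sumr -big_split; apply: eq_bigr => j _ /=; ring.
Qed.

Lemma deltaN n (w : form n) z : delta (fun y => - w y) z = - delta w z.
Proof.
case: n w z => [|n] w z /=; first by rewrite oppr0.
rewrite -sumrN; apply: eq_bigr => i _; rewrite -sumrN.
by apply: eq_bigr => j _; rewrite !mulrN.
Qed.

Lemma alternating_mulg n (w : form n) (s t : 'S_n) :
  (forall z, w (z \o s) = (-1) ^+ s * w z) ->
  (forall z, w (z \o t) = (-1) ^+ t * w z) ->
  forall z, w (z \o (s * t)%g) = (-1) ^+ (s * t)%g * w z.
Proof.
move=> ws wt z; rewrite odd_permM signr_addb -mulrA -wt -ws.
by congr w; apply: funext => k; rewrite /= permM.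
Qed.

(** The stabilizer of the first position and the exchange of the first two
    generate the symmetric group, so alternation may be checked on these. *)
Lemma alternating_of_contract n (w : form n.+2) :
    (forall a, alternating (contract a w)) ->
    (forall a b z, w (fcons a (fcons b z)) = - w (fcons b (fcons a z))) ->
  alternating w.
Proof.
move=> w_tail w_swap.
have w_lift s z : w (z \o lift_perm ord0 ord0 s) = (-1) ^+ lift_perm ord0 ord0 s * w z.
  rewrite -{1}(fcons_eta z) -fcons_comp_lift_perm.
  have /= := w_tail (z ord0) s; rewrite /contract => ->.
  by rewrite fcons_eta odd_lift_perm addbb.
pose p1 : 'I_n.+2 := lift ord0 (ord0 : 'I_n.+1).
have w_01 (z : 'I_n.+2 -> Z) : w (z \o tperm ord0 p1)
            = (-1) ^+ tperm ord0 p1 * w z.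
  rewrite odd_tperm /= mulN1r -{2}(fcons_eta z) -(fcons_eta (z \o lift ord0)).
  rewrite w_swap opprK; congr w.
  apply: fconsP => [|k] /=; first by rewrite tpermL fcons0.
  rewrite fconsS; case: (unliftP ord0 k) => [l|] ->; last by rewrite tpermR fcons0.
  by rewrite fconsS tpermD.
have w_lift2 x y z : w (z \o tperm (lift ord0 x) (lift ord0 y))
    = (-1) ^+ tperm (lift ord0 x) (lift ord0 y) * w z.
  suff -> : tperm (lift ord0 x) (lift ord0 y) = lift_perm ord0 ord0 (tperm x y).
    exact: w_lift.
  apply/permP => k; case: (unliftP ord0 k) => [l|] ->.
    rewrite lift_perm_lift; case: (tpermP x y l) => [->|->|/eqP nx /eqP ny].
    - by rewrite tpermL.
    - by rewrite tpermR.
    - by rewrite tpermD //; rewrite (inj_eq (@lift_inj _ _)) eq_sym.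
  by rewrite lift_perm_id tpermD.
have w_0 y z : w (z \o tperm ord0 (lift ord0 y)) = (-1) ^+ tperm ord0 (lift ord0 y) * w z.
  have [->|y0] := eqVneq y ord0; first exact: w_01.
  have -> : tperm ord0 (lift ord0 y)
     = (tperm p1 (lift ord0 y) * (tperm ord0 p1 *
        tperm p1 (lift ord0 y)))%g.
    by rewrite -{1}(tpermV p1) -/(conjg _ _) tpermJ tpermL tpermD.
  have w_1y z' := w_lift2 ord0 y z'.
  by apply: alternating_mulg => //; apply: alternating_mulg.
have w_tperm x y z : w (z \o tperm x y) = (-1) ^+ tperm x y * w z.
  case: (unliftP ord0 x) => [x'|] ->; case: (unliftP ord0 y) => [y'|] -> //.
    by rewrite tpermC.
  by rewrite tperm1 odd_perm1 mul1r; congr w; apply: funext => k; rewrite /= perm1.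
move=> s; have [ts -> _] := prod_tpermP s.
elim: ts => [|t ts IH] z.
  rewrite big_nil odd_perm1 mul1r; congr w; apply: funext => k; by rewrite /= perm1.
by rewrite big_cons; apply: alternating_mulg.
Qed.

Hypothesis c_skew : forall x y, c y x = - c x y.
Hypothesis mulC : forall x y, mul x y = mul y x.

Lemma lie_fcons n a b (w : form n.+1) z :
  lie a w (fcons b z) = c a b * w (fcons (mul a b) z) + lie a (contract b w) z.
Proof.
rewrite /lie big_ord_recl fcons0; congr (_ * w _ + _).
  by apply: fconsP => [|k]; rewrite /replace ?fcons0 ?fconsS.
apply: eq_bigr => j _; rewrite fconsS; congr (_ * w _).
by apply: fconsP => [|k]; rewrite /replace ?fcons0 ?fconsS.
Qed.

(** Applying Cartan's formula twice leaves an expression that is antisymmetric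
    in the two contracted elements. *)
Lemma delta_swap n (w : form n.+1) : alternating w ->
  forall a b z, delta w (fcons a (fcons b z)) = - delta w (fcons b (fcons a z)).
Proof.
move=> w_alt a b z; rewrite !cartan // !lie_fcons (mulC b a) (c_skew a b).
case: n w z w_alt => [|n] w z w_alt.
  by rewrite /lie !big_ord0 /=; ring.
have wa := alternating_contract a w_alt; have wb := alternating_contract b w_alt.
rewrite [delta _ (fcons b z)](cartan _ _ wa) [delta _ (fcons a z)](cartan _ _ wb).
rewrite (_ : contract a (contract b w) = fun y => - contract b (contract a w) y).
  by rewrite deltaN; ring.
by apply: funext => y; rewrite /contract alternating_swap.
Qed.

(** Induction on the degree: by Cartan's formula, contracting [delta w] gives
    forms that are alternating by the induction hypothesis. *)
Lemma alternating_delta n (w : form n) : alternating w -> alternating (delta w).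
Proof.
elim: n w => [|n IH] w w_alt; first by move=> s z; rewrite mulr0.
case: n IH w w_alt => [|n] IH w w_alt; last first.
  apply: alternating_of_contract => [a s z|]; last exact: delta_swap.
  rewrite /contract !cartan // (alternating_lie a w_alt).
  by rewrite (IH _ (alternating_contract a w_alt)) mulrBr mulrN.
apply: alternating_of_contract => [a s z|]; last exact: delta_swap.
by rewrite /contract !cartan // (alternating_lie a w_alt) /= mulrBr mulr0 mulrN.
Qed.

Variable wt : Z -> int.
Hypothesis wt_mul : forall x y, c x y != 0 -> wt (mul x y) = wt x + wt y.

Definition weight n (z : 'I_n -> Z) : int := \sum_k wt (z k).

Lemma weight_fcons n a (z : 'I_n -> Z) : weight (fcons a z) = wt a + weight z.
Proof.
rewrite /weight big_ord_recl fcons0; congr (_ + _).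
by apply: eq_bigr => k _; rewrite fconsS.
Qed.

Lemma weight_skip2 n (i j : 'I_n.+2) z : (i < j)%N ->
  weight z = wt (z i) + wt (z j) + weight (z \o skip2 i j).
Proof.
move=> ij; rewrite /weight (bigD1_ord j) //= (bigD1_ord (inord i)) //=.
rewrite addrCA addrA; congr (_ + _ + _); congr (wt (z _)).
by apply/val_inj; rewrite /= /bump inordK; have := ltn_ord j; lia.
Qed.

(** The bracket preserves the weight, so the differential acts inside each
    weight space. *)
Lemma delta_weight n (f : int -> K) (w : form n) z :
  delta (fun y => f (weight y) * w y) z = f (weight z) * delta w z.
Proof.
case: n w z => [|n] w z /=; first by rewrite mulr0.
rewrite mulr_sumr; apply: eq_bigr => i _; rewrite mulr_sumr; apply: eq_bigr => j ij.
have [->|cij] := eqVneq (c (z i) (z j)) 0; first by rewrite !mul0r !mulr0.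
by rewrite weight_fcons wt_mul // -(weight_skip2 _ ij); ring.
Qed.

Lemma alternating_weight n (f : int -> K) (w : form n) :
  alternating w -> alternating (fun y => f (weight y) * w y).
Proof.
move=> w_alt s z; rewrite w_alt mulrCA; congr (_ * (f _ * _)).
by rewrite /weight [RHS](reindex_inj (@perm_inj _ s)).
Qed.

Definition diagonal a := forall x, c a x != 0 -> mul a x = x.

Lemma lie_diagonal n a (w : form n) z : diagonal a ->
  lie a w z = (\sum_j c a (z j)) * w z.
Proof.
move=> a_diag; rewrite mulr_suml; apply: eq_bigr => j _.
have [->|/a_diag ->] := eqVneq (c a (z j)) 0; first by rewrite !mul0r.
by congr (_ * w _); apply: funext => k; rewrite /replace; case: eqP => [->|].
Qed.

Variables (a b : Z) (r : K).
Hypotheses (a_diag : diagonal a) (b_diag : diagonal b).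
Hypothesis euler : forall x, c a x + r * c b x = - (wt x)%:~R.

(** Contraction with [a + r b], which acts on [x] by minus its weight. *)
Definition contract_euler n (w : form n.+1) : form n :=
  fun z => r * contract b w z + contract a w z.

Lemma alternating_contract_euler n (w : form n.+1) :
  alternating w -> alternating (contract_euler w).
Proof.
by move=> w_alt s z; rewrite /contract_euler !(alternating_contract _ w_alt) mulrDr mulrCA.
Qed.

(** On a closed form Cartan's formula reduces to the action of [a + r b]. *)
Lemma delta_contract_euler n (w : form n.+1) z :
    alternating w -> (forall y, delta w y = 0) ->
  delta (contract_euler w) z = (weight z)%:~R * w z.
Proof.
move=> w_alt w_closed; rewrite delta_linear.
have /eqP := cartan a z w_alt; rewrite w_closed eq_sym subr_eq0 => /eqP <-.
have /eqP := cartan b z w_alt; rewrite w_closed eq_sym subr_eq0 => /eqP <-.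
rewrite !lie_diagonal // !mulrN mulrA -opprD -mulrDl mulr_sumr -big_split /=.
rewrite -mulNr -sumrN rmorph_sum; congr (_ * _); apply: eq_bigr => j _.
by rewrite addrC euler opprK.
Qed.
End MonomialLie.

Section Homotopy.
Variables (K : fieldType) (Z : Type) (c : Z -> Z -> K) (mul : Z -> Z -> Z).
Variable wt : Z -> int.
Hypothesis wt_mul : forall x y, c x y != 0 -> wt (mul x y) = wt x + wt y.
Variables (a b : Z) (r : K).
Hypotheses (a_diag : diagonal c mul a) (b_diag : diagonal c mul b).
Hypothesis euler : forall x, c a x + r * c b x = - (wt x)%:~R.
Hypothesis char0 : [pchar K] =i pred0.

Lemma char0_intr_eq0 (x : int) : (x%:~R == 0 :> K) = (x == 0).
Proof.
case: (intP x) => [|n|n]; rewrite ?mulr0z ?eqxx //.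
  by rewrite -pmulrn (pcharf0P _).1.
by rewrite mulrNz oppr_eq0 -pmulrn (pcharf0P _).1.
Qed.

Definition balanced_part n (w : form K Z n) : form K Z n :=
  fun z => (weight wt z == 0)%:R * w z.

(** In weight zero the inverse is [0^-1 = 0], so that this primitive only sees
    the other weights. *)
Definition primitive n (w : form K Z n.+1) : form K Z n :=
  contract_euler a b r (fun z => (weight wt z)%:~R^-1 * w z).

(** A Lie algebra acts trivially on its cohomology, and [a + r b] acts by the
    weight, up to sign; hence only weight zero contributes to cohomology. *)
Lemma closed_balanced n (w : form K Z n.+1) :
    alternating w -> (forall z, delta c mul w z = 0) ->
  forall z, w z = balanced_part w z + delta c mul (primitive w) z.
Proof.
move=> w_alt w_closed z; rewrite /primitive (delta_contract_euler a_diag b_diag euler).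
- rewrite /balanced_part; have [->|wz] := eqVneq (weight wt z) 0.
    by rewrite mul1r mul0r addr0.
  by rewrite mul0r add0r mulVKf // char0_intr_eq0.
- exact: (alternating_weight wt (fun x => x%:~R^-1)).
- by move=> y; rewrite (delta_weight wt_mul (fun x => x%:~R^-1)) w_closed mulr0.
Qed.
End Homotopy.

(** * Alternating forms supported on bases *)

Section Dual.
Variables (K : fieldType) (Z : eqType).

Definition entries n (z : 'I_n -> Z) : n.-tuple Z := [tuple z k | k < n].

Lemma perm_entriesP n (z l : 'I_n -> Z) :
  reflect (exists s : 'S_n, z = l \o s) (perm_eq (entries z) (entries l)).
Proof.
apply: (iffP tuple_permP) => [[s E]|[s ->]]; exists s.
  apply: funext => k; have /(congr1 (fun q => tnth q k)) : entries z = entries (l \o s).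
    by apply: val_inj; apply: (etrans E); apply: eq_map => i; rewrite tnth_mktuple.
  by rewrite !tnth_mktuple.
by apply: eq_map => i; rewrite tnth_mktuple.
Qed.

(** The exterior product of the linear forms dual to the basis elements
    [l 0, ..., l (n - 1)]. *)
Definition dual n (l : 'I_n -> Z) : form K Z n :=
  fun z => \det (\matrix_(k, j) (z k == l j)%:R).

Lemma alternating_dual n (l : 'I_n -> Z) : alternating (dual l).
Proof.
move=> s z; rewrite /dual -det_perm -det_mulmx -row_permE; congr (\det _).
by apply/matrixP => k j; rewrite !mxE.
Qed.

Lemma dual_sum n (l z : 'I_n -> Z) :
  dual l z = \sum_(s : 'S_n) (-1) ^+ s * (z == l \o s)%:R.
Proof.
rewrite /dual; apply: eq_bigr => s _; congr (_ * _).
have [->|nz] := eqVneq z (l \o s).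
  by rewrite big1 // => k _; rewrite mxE eqxx.
have [k zk] : exists k, z k != l (s k).
  apply/existsP; rewrite -negb_forall; apply: contra nz => /forallP E.
  by apply/eqP/funext => k; apply/eqP.
by rewrite (bigD1 k) //= mxE (negbTE zk) mul0r.
Qed.

Lemma dual_perm_eq n (l z : 'I_n -> Z) :
  dual l z != 0 -> perm_eq (entries z) (entries l).
Proof.
move=> nz; apply/perm_entriesP; suff [s /eqP ->] : exists s : 'S_n, z == l \o s.
  by exists s.
apply/existsP; apply: contraNT nz; rewrite negb_exists => /forallP E.
by rewrite dual_sum big1 // => s _; rewrite (negbTE (E s)) mulr0.
Qed.

Lemma dual_id n (l : 'I_n -> Z) : injective l -> dual l l = 1.
Proof.
move=> l_inj; rewrite /dual -[RHS](det1 _ n); congr (\det _).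
apply/matrixP => k j; rewrite !mxE (inj_eq l_inj); by case: eqVneq.
Qed.

Hypothesis char0 : [pchar K] =i pred0.

Lemma alternating_inj n (w : form K Z n) z :
  alternating w -> w z != 0 -> injective z.
Proof.
move=> w_alt wz i j zij; apply/eqP; apply: contraNT wz => ij.
have : w z *+ 2 = 0.
  rewrite mulr2n -{1}(opprK (w z)) -(alternating_tperm w_alt z ij).
  rewrite (_ : z \o _ = z) ?addNr //; apply: funext => k /=.
  by case: tpermP => [->|->|].
by move/eqP; rewrite -mulr_natr mulf_eq0 (pcharf0P _).1 // orbF.
Qed.

Lemma alternating_eq n (w w' : form K Z n) (z l : 'I_n -> Z) :
    alternating w -> alternating w' -> perm_eq (entries z) (entries l) ->
  w l = w' l -> w z = w' z.
Proof.
by move=> w_alt w'_alt /perm_entriesP [s ->] wl; rewrite w_alt w'_alt wl.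
Qed.
End Dual.

(** * The annihilation algebra *)

Section AnnihilationAlgebra.
Variable K : fieldType.
Hypothesis char0 : [pchar K] =i pred0.

Notation Z := ('I_4 * nat)%type.
Implicit Types x y : Z.

(** When [e_g] and [e_h] commute the value is chosen only so as to keep the
    function symmetric in [g] and [h]. *)
Definition br_gen (g h : 'I_4) : 'I_4 :=
  match val g, val h with
  | 0, _ => h
  | 1, 0 => gN
  | 1, _ => h
  | 2, 2 | 2, 3 => gM
  | _, _ => g
  end.

(** The degree in [lambda] and [d] of the coefficient of the bracket, by
    convention 1 when it is zero. *)
Definition br_deg (g h : 'I_4) : nat :=
  match val g, val h with
  | 1, 2 | 1, 3 | 2, 1 | 3, 1 => 0
  | _, _ => 1
  end.

(** The triple [(alpha, beta, kappa)] encodes the coefficient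
    [alpha lambda + beta (- lambda - d) + kappa] of [[e_g lambda e_h]].  In these
    coordinates skew-symmetry exchanges [alpha] and [beta], and the differential
    reads them as the coefficients of [lambda_i] and [lambda_j]. *)
Definition br_coef (g h : 'I_4) : K * K * K :=
  match val g, val h with
  | 0, 0 => (1, -1, 0)
  | 0, 1 => (0, -1, 0)
  | 1, 0 => (1, 0, 0)
  | 0, 2 => (2%:R^-1, -1, 0)
  | 2, 0 => (1, - 2%:R^-1, 0)
  | 0, 3 => (0, -1, 0)
  | 3, 0 => (1, 0, 0)
  | 1, 2 => (0, 0, 1)
  | 2, 1 => (0, 0, -1)
  | 1, 3 => (0, 0, 2%:R)
  | 3, 1 => (0, 0, - 2%:R)
  | 2, 2 => (1, -1, 0)
  | _, _ => (0, 0, 0)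
  end.

(** The pair [(g, m)] stands for the basis element [(e_g)_m].  The subtraction
    is truncated only if both exponents vanish in a bracket of degree 1, and
    then [ann_coef] is zero. *)
Definition ann_mul (x y : Z) : Z :=
  (br_gen x.1 y.1, (x.2 + y.2 - br_deg x.1 y.1)%N).

Definition ann_coef (x y : Z) : K :=
  let t := br_coef x.1 y.1 in t.1.1 * x.2%:R + t.1.2 * y.2%:R + t.2.

Lemma ann_coef_skew x y : ann_coef y x = - ann_coef x y.
Proof.
case: x y => [[[|[|[|[|//]]]] ?] m] [[[|[|[|[|//]]]] ?] m'];
  rewrite /ann_coef /br_coef /=; ring.
Qed.

Lemma ann_mulC x y : ann_mul x y = ann_mul y x.
Proof.
case: x y => [[[|[|[|[|//]]]] ?] m] [[[|[|[|[|//]]]] ?] m'];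
  rewrite /ann_mul /br_gen /br_deg /= addnC; congr pair.
all: exact: val_inj.
Qed.

Definition Lm m : Z := (gL, m).
Definition Nm m : Z := (gN, m).

(** Minus the eigenvalue of [L_1 - 5/2 N_0] on [x], as [ann_euler] shows.  The
    weights for [L_1] alone are [m - 1], [m], [m - 1/2] and [m]. *)
Definition ann_wt (x : Z) : int :=
  match val x.1 with
  | 0 => x.2%:Z - 1
  | 1 => x.2%:Z
  | 2 => x.2%:Z + 2
  | _ => x.2%:Z + 5
  end.

Lemma ann_wt_mul x y : ann_coef x y != 0 ->
  ann_wt (ann_mul x y) = ann_wt x + ann_wt y.
Proof.
have [E|nE] := boolP ((x.2 + y.2 == 0)%N && (br_deg x.1 y.1 == 1)%N).
  case/andP: E => /eqP; case: x y => [g [|m]] [h [|m']] //= _ hd.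
  rewrite /ann_coef /= !mulr0 !add0r.
  by case: g h hd => [[|[|[|[|//]]]] ?] [[|[|[|[|//]]]] ?]; rewrite /br_coef //= eqxx.
case: x y nE => [[[|[|[|[|//]]]] ?] m] [[[|[|[|[|//]]]] ?] m'];
  rewrite /ann_coef /br_coef /ann_wt /ann_mul /br_gen /br_deg /= ?mul0r ?addr0 ?eqxx //; lia.
Qed.

Lemma diagonal_L1 : diagonal ann_coef ann_mul (Lm 1).
Proof.
by move=> [[[|[|[|[|//]]]] ?] m] _; rewrite /ann_mul /br_gen /br_deg /= add1n subn1;
  congr pair; exact: val_inj.
Qed.

Lemma diagonal_N0 : diagonal ann_coef ann_mul (Nm 0).
Proof.
move=> [[[|[|[|[|//]]]] ?] m]; rewrite /ann_coef /br_coef /ann_mul /br_gen /br_deg /=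
  ?mul0r ?mulr0 ?addr0 ?eqxx //= add0n subn0 => _; congr pair; exact: val_inj.
Qed.

Lemma ann_euler x :
  ann_coef (Lm 1) x + - (5%:R / 2%:R) * ann_coef (Nm 0) x = - (ann_wt x)%:~R.
Proof.
have two0 : 2%:R != 0 :> K by rewrite (pcharf0P _).1.
case: x => [[[|[|[|[|//]]]] ?] m]; rewrite /ann_coef /br_coef /ann_wt /=
  ?rmorphD ?rmorphN -?pmulrn /=; field => //.
Qed.

Definition light : seq Z := [:: Lm 2; Lm 1; Lm 0; Nm 1; Nm 0].

Lemma ann_wt_light x : ann_wt x <= 1 -> x \in light.
Proof.
by case: x => [[[|[|[|[|//]]]] i4] [|[|[|m]]]] //=; rewrite /ann_wt //= => _;
  rewrite (bool_irrelevance i4 isT).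
Qed.

(** The sets of basis elements of total weight zero. *)
Definition balanced_lists : seq (seq Z) :=
  [:: [::]; [:: Lm 1]; [:: Nm 0]; [:: Lm 1; Nm 0]; [:: Lm 2; Lm 0]; [:: Lm 0; Nm 1];
      [:: Lm 2; Lm 1; Lm 0]; [:: Lm 2; Lm 0; Nm 0]; [:: Lm 1; Lm 0; Nm 1];
      [:: Lm 0; Nm 1; Nm 0];
      [:: Lm 2; Lm 1; Lm 0; Nm 0]; [:: Lm 1; Lm 0; Nm 1; Nm 0]].

Lemma sum_wt_ge (s : seq Z) : uniq s -> -1 <= \sum_(x <- s) ann_wt x.
Proof.
have pos x : x != Lm 0 -> 0 <= ann_wt x.
  apply: contraTT; rewrite negbK => wx; apply/eqP; move: wx.
  case: x => [[[|[|[|[|//]]]] i4] m]; rewrite /ann_wt /= => wx; try lia.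
  by rewrite (bool_irrelevance i4 isT); congr pair; lia.
move=> s_uniq; have [L0s|L0s] := boolP (Lm 0 \in s); last first.
  apply: (@Order.POrderTheory.le_trans _ _ 0) => //; rewrite big_seq;
    apply: Num.Theory.sumr_ge0 => x xs.
  by apply: pos; apply: contraNneq L0s => <-.
rewrite (bigD1_seq (Lm 0)) //= -[leLHS]addr0 Num.Theory.lerD2l.
by apply: Num.Theory.sumr_ge0.
Qed.

(** Only [L_0] has negative weight, namely -1, and it occurs at most once, so
    that no entry has a weight above 1.  This leaves the 32 subsets of [light],
    whose weights are computed. *)
Lemma balanced_listsP (s : seq Z) : uniq s -> \sum_(x <- s) ann_wt x = 0 ->
  has (perm_eq s) balanced_lists.
Proof.
move=> s_uniq s_wt.
have s_light x : x \in s -> x \in light.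
  move=> xs; apply: ann_wt_light; have := sum_wt_ge (rem_uniq x s_uniq).
  have : ann_wt x + \sum_(y <- rem x s) ann_wt y = 0.
    by apply: etrans s_wt; rewrite [RHS](big_rem x xs).
  by move: (ann_wt x) (\sum_(y <- rem x s) ann_wt y) => u v; lia.
have s_perm : perm_eq s (filter (mem s) light).
  apply: uniq_perm => // [|x]; first by rewrite filter_uniq.
  by rewrite mem_filter /=; apply/idP/andP => [xs|[]//]; split; rewrite ?s_light.
move: s_wt; rewrite (perm_big _ s_perm) /=.
suff: forall l, perm_eq s l -> l \in balanced_lists -> has (perm_eq s) balanced_lists.
  move=> suf; move: s_perm => /=.
  by do 5 case: (_ \in s); rewrite unlock //= => sp _; apply: (suf _ sp).
by move=> l sl lb; apply/hasP; exists l.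
Qed.
End AnnihilationAlgebra.

(** * Forms of weight zero *)

Section Balanced.
Variable K : fieldType.
Hypothesis char0 : [pchar K] =i pred0.

Notation Z := ('I_4 * nat)%type.
Notation form := (form K Z).
Notation dl := (delta (@ann_coef K) ann_mul).

Arguments delta : simpl never.

(** The default value [Lm 0] is only reached when [l] is shorter than [n]. *)
Definition tup (l : seq Z) {n} : 'I_n -> Z := fun k => nth (Lm 0) l k.

Lemma tup_cons n a l : tup (a :: l) (n := n.+1) = fcons a (tup l (n := n)).
Proof. by apply: fconsP => [|k]; rewrite ?fcons0 ?fconsS. Qed.

Lemma entries_tup n l : size l = n -> entries (tup l (n := n)) = l :> seq Z.
Proof.
move=> l_n; apply: (@eq_from_nth _ (Lm 0)); rewrite size_tuple // => i i_n.
by rewrite (nth_mktuple _ _ (Ordinal i_n)).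
Qed.

Definition balanced n (w : form n) := forall z, weight ann_wt z != 0 -> w z = 0.

Lemma balanced_delta n (w : form n) : balanced w -> balanced (dl w).
Proof.
move=> w_bal z wz; rewrite (_ : w = fun y => (weight ann_wt y == 0)%:R * w y).
  by rewrite (delta_weight (@ann_wt_mul K) (fun x => (x == 0)%:R)) (negbTE wz) mul0r.
apply: funext => y; have [|/w_bal ->] := eqVneq (weight ann_wt y) 0; by rewrite ?mul1r ?mulr0.
Qed.

Lemma balanced_balanced_part n (w : form n) : balanced (balanced_part ann_wt w).
Proof. by move=> z wz; rewrite /balanced_part (negbTE wz) mul0r. Qed.

(** An alternating form is determined by its values on one ordering of each set
    of arguments, and in weight zero there are at most four sets per degree. *)
Lemma balanced_ext n (w w' : form n) :
    alternating w -> alternating w' -> balanced w -> balanced w' ->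
    {in [seq l <- balanced_lists | size l == n], forall l, w (tup l) = w' (tup l)} ->
  forall z, w z = w' z.
Proof.
move=> w_alt w'_alt w_bal w'_bal E z.
have [wz|nz] := eqVneq (weight ann_wt z) 0; last by rewrite w_bal ?w'_bal.
have [z_inj|z_ninj] := pselect (injective z); last first.
  have [->|/(alternating_inj char0 w_alt)//] := eqVneq (w z) 0.
  by have [->|/(alternating_inj char0 w'_alt)//] := eqVneq (w' z) 0.
have u : uniq (entries z) by rewrite map_inj_uniq ?enum_uniq.
have /hasP [l lb pl] : has (perm_eq (entries z)) balanced_lists.
  apply: balanced_listsP u _; rewrite -[RHS]wz /weight big_tuple; apply: eq_bigr => k _.
  by rewrite tnth_mktuple.
have l_n : size l = n by rewrite -(perm_size pl) size_tuple.
apply: (alternating_eq (l := tup l) w_alt w'_alt); first by rewrite entries_tup.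
by apply: E; rewrite mem_filter l_n eqxx lb.
Qed.

Lemma delta_tup2 (w : form 1) a b : alternating w ->
  dl w (tup [:: a; b] (n := 2)) = - (ann_coef K a b * w (tup [:: ann_mul a b] (n := 1))).
Proof.
by move=> w_alt; rewrite !tup_cons cartan // lie_fcons /lie big_ord0 subr0 addr0.
Qed.

Lemma delta_tup3 (w : form 2) a b d : alternating w ->
  dl w (tup [:: a; b; d] (n := 3)) =
   ann_coef K b d * w (tup [:: a; ann_mul b d] (n := 2)) -
  (ann_coef K a b * w (tup [:: ann_mul a b; d] (n := 2)) +
   ann_coef K a d * w (tup [:: b; ann_mul a d] (n := 2))).
Proof.
move=> w_alt; have wa x := alternating_contract x w_alt.
rewrite [in LHS]tup_cons cartan // delta_tup2 // !tup_cons !lie_fcons /lie big_ord0 addr0.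
rewrite /contract; ring.
Qed.

Lemma delta_tup4 (w : form 3) a b d e : alternating w ->
  dl w (tup [:: a; b; d; e] (n := 4)) =
  ann_coef K b d * w (tup [:: a; ann_mul b d; e] (n := 3)) +
  ann_coef K b e * w (tup [:: a; d; ann_mul b e] (n := 3)) -
  ann_coef K d e * w (tup [:: a; b; ann_mul d e] (n := 3)) -
  (ann_coef K a b * w (tup [:: ann_mul a b; d; e] (n := 3)) +
   ann_coef K a d * w (tup [:: b; ann_mul a d; e] (n := 3)) +
   ann_coef K a e * w (tup [:: b; d; ann_mul a e] (n := 3))).
Proof.
move=> w_alt; have wa x := alternating_contract x w_alt.
rewrite [in LHS]tup_cons cartan // delta_tup3 // !tup_cons !lie_fcons /lie big_ord0 addr0.
rewrite /contract; ring.
Qed.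

Lemma alternating_swap_head n (w : form n.+2) a b l : alternating w ->
  w (tup (a :: b :: l) (n := n.+2)) = - w (tup (b :: a :: l) (n := n.+2)).
Proof. by move=> w_alt; rewrite !tup_cons alternating_swap. Qed.

Lemma alternating_dup n (w : form n) l : alternating w -> size l = n -> ~~ uniq l ->
  w (tup l (n := n)) = 0.
Proof.
move=> w_alt l_n l_nu; apply/eqP; apply: contraNT l_nu => wl.
have l_inj := alternating_inj char0 w_alt wl.
by rewrite -(entries_tup l_n) map_inj_uniq ?enum_uniq.
Qed.

Definition edual l {n} : form n := dual K (tup l (n := n)).

Lemma alternating_edual l n : alternating (edual l (n := n)).
Proof. exact: alternating_dual. Qed.

Lemma edual_tup l l' n : size l = n -> size l' = n -> uniq l ->
  (l == l') || ~~ perm_eq l' l -> edual l (tup l' (n := n)) = (l == l')%:R.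
Proof.
move=> l_n l'_n l_uniq; have [<- _|_ /= l'l] := eqVneq l l'.
  by apply: dual_id; apply/injectiveP; rewrite -(entries_tup l_n) in l_uniq.
by apply/eqP; apply: contraNT l'l => /dual_perm_eq; rewrite !entries_tup.
Qed.

Lemma balanced_edual l n : size l = n -> \sum_(x <- l) ann_wt x = 0 ->
  balanced (edual l (n := n)).
Proof.
move=> l_n l_wt z wz; apply/eqP; apply: contraNT wz => /dual_perm_eq.
rewrite (entries_tup l_n) => pz; rewrite -l_wt -(perm_big _ pz) big_tuple;
  apply/eqP/eq_bigr => k _.
by rewrite tnth_mktuple.
Qed.

Lemma alternating0 n : alternating (fun _ => 0 : K) (n := n) (Z := Z).
Proof. by move=> s z; rewrite mulr0. Qed.

Lemma alternatingD n (w w' : form n) :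
  alternating w -> alternating w' -> alternating (fun z => w z + w' z).
Proof. by move=> w_alt w'_alt s z; rewrite w_alt w'_alt mulrDr. Qed.

Lemma alternatingZ n (x : K) (w : form n) :
  alternating w -> alternating (fun z => x * w z).
Proof. by move=> w_alt s z; rewrite w_alt mulrCA. Qed.

Lemma balancedD n (w w' : form n) :
  balanced w -> balanced w' -> balanced (fun z => w z + w' z).
Proof. by move=> w_bal w'_bal z wz; rewrite w_bal ?w'_bal ?addr0. Qed.

Lemma balancedZ n (x : K) (w : form n) :
  balanced w -> balanced (fun z => x * w z).
Proof. by move=> w_bal z wz; rewrite w_bal ?mulr0. Qed.

Lemma alternating_dl n (w : form n) : alternating w -> alternating (dl w).
Proof. exact: alternating_delta (@ann_coef_skew K) ann_mulC _ _. Qed.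

Lemma ann_LL m n : ann_coef K (Lm m) (Lm n) = m%:R - n%:R.
Proof. rewrite /ann_coef /=; ring. Qed.
Lemma ann_LN m n : ann_coef K (Lm m) (Nm n) = - n%:R.
Proof. rewrite /ann_coef /=; ring. Qed.
Lemma ann_NL m n : ann_coef K (Nm m) (Lm n) = m%:R.
Proof. rewrite /ann_coef /=; ring. Qed.
Lemma ann_NN m n : ann_coef K (Nm m) (Nm n) = 0.
Proof. rewrite /ann_coef /=; ring. Qed.
Definition ann_coefE := (ann_LL, ann_LN, ann_NL, ann_NN).

(* [Nat.pred] and [Nat.add] let numerals be evaluated by simplification. *)
Lemma mul_LL m n : ann_mul (Lm m) (Lm n) = Lm (Nat.pred (Nat.add m n)).
Proof. by rewrite /ann_mul /= subn1. Qed.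
Lemma mul_LN m n : ann_mul (Lm m) (Nm n) = Nm (Nat.pred (Nat.add m n)).
Proof. by rewrite /ann_mul /= subn1. Qed.
Lemma mul_NL m n : ann_mul (Nm m) (Lm n) = Nm (Nat.pred (Nat.add m n)).
Proof. by rewrite /ann_mul /= subn1. Qed.
(* The coefficient of [Nm m] and [Nm n] is zero, whatever their product. *)
Definition ann_mulE := (mul_LL, mul_LN, mul_NL).

Lemma two_neq0 : 2%:R != 0 :> K. Proof. by rewrite (pcharf0P _).1. Qed.

(** Closedness on [L_2, L_0] and on [L_0, N_1] kills the values at [L_1] and
    [N_0]. *)
Lemma closed_balanced1 (w : form 1) :
  alternating w -> balanced w -> (forall z, dl w z = 0) -> forall z, w z = 0.
Proof.
move=> w_alt w_bal w_closed.
have L1 := w_closed (tup [:: Lm 2; Lm 0]); have N0 := w_closed (tup [:: Lm 0; Nm 1]).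
move: L1 N0; rewrite !delta_tup2 // !ann_coefE !ann_mulE /= => L1 N0.
apply: balanced_ext => //; first exact: alternating0.
move=> l; rewrite !inE => /orP[] /eqP -> //.
  by move: L1 => /eqP; rewrite subr0 oppr_eq0 mulf_eq0 (negbTE two_neq0) => /eqP.
by move: N0; rewrite mulN1r opprK.
Qed.

(** The differential maps the spans of [L_1] and [N_0] onto those of [L_2 L_0]
    and [L_0 N_1]; the third coefficient, at [L_1 N_0], is killed by closedness
    on [L_2, L_0, N_0]. *)
Lemma closed_balanced2 (w : form 2) :
    alternating w -> balanced w -> (forall z, dl w z = 0) ->
  exists x y, forall z, w z = dl (fun z' => x * edual [:: Lm 1] z' + y * edual [:: Nm 0] z') z.
Proof.
move=> w_alt w_bal w_closed.
exists (- w (tup [:: Lm 2; Lm 0]) / 2%:R), (w (tup [:: Lm 0; Nm 1])).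
set eta := fun z' => _.
have eta_alt : alternating eta.
  by apply: alternatingD; apply: alternatingZ; apply: alternating_edual.
have eta_bal : balanced eta.
  by apply: balancedD; apply: balancedZ; apply: balanced_edual; rewrite // unlock.
have L1N0 := w_closed (tup [:: Lm 2; Lm 0; Nm 0]).
move: L1N0; rewrite delta_tup3 // !ann_coefE !ann_mulE /= => /eqP.
rewrite subr0 oppr0 !mul0r addr0 sub0r oppr_eq0 mulf_eq0 (negbTE two_neq0) => /eqP L1N0.
apply: balanced_ext => //; [exact: alternating_dl | exact: balanced_delta|].
move=> l; rewrite !inE => /or3P[] /eqP ->; cbv beta;
  rewrite delta_tup2 // !ann_coefE !ann_mulE /=.
- by rewrite oppr0 mul0r oppr0.
- by rewrite /eta !edual_tup //=; field; rewrite two_neq0.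
- by rewrite /eta !edual_tup //=; ring.
Qed.

(** The coboundary of [L_1 N_0] takes the place of [L_2 L_0 N_0] in the basis of
    monomials. *)
Lemma balanced3 (w : form 3) : alternating w -> balanced w ->
  exists x y u v, forall z, w z =
    x * dl (edual [:: Lm 1; Nm 0]) z + (y * edual [:: Lm 0; Nm 1; Nm 0] z +
    (u * edual [:: Lm 1; Lm 0; Nm 1] z + v * edual [:: Lm 2; Lm 1; Lm 0] z)).
Proof.
move=> w_alt w_bal.
exists (- w (tup [:: Lm 2; Lm 0; Nm 0]) / 2%:R), (w (tup [:: Lm 0; Nm 1; Nm 0])).
exists (w (tup [:: Lm 1; Lm 0; Nm 1]) - w (tup [:: Lm 2; Lm 0; Nm 0]) / 2%:R).
exists (w (tup [:: Lm 2; Lm 1; Lm 0])).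
apply: balanced_ext => //.
- by apply: alternatingD; [|apply: alternatingD; [|apply: alternatingD]]; apply: alternatingZ;
     [apply: alternating_dl|..]; apply: alternating_edual.
- by apply: balancedD; [|apply: balancedD; [|apply: balancedD]]; apply: balancedZ;
     [apply: balanced_delta|..]; apply: balanced_edual; rewrite // unlock.
move=> l; rewrite !inE => /or4P[] /eqP ->; cbv beta;
  rewrite delta_tup3 ?ann_coefE ?ann_mulE ?edual_tup //=; try exact: alternating_edual;
  by field; rewrite two_neq0.
Qed.

Lemma balanced4 (w : form 4) : alternating w -> balanced w ->
  exists u v, forall z, w z =
    u * edual [:: Lm 1; Lm 0; Nm 1; Nm 0] z + v * edual [:: Lm 2; Lm 1; Lm 0; Nm 0] z.
Proof.
move=> w_alt w_bal.
exists (w (tup [:: Lm 1; Lm 0; Nm 1; Nm 0])), (w (tup [:: Lm 2; Lm 1; Lm 0; Nm 0])).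
apply: balanced_ext => //.
- by apply: alternatingD; apply: alternatingZ; apply: alternating_edual.
- by apply: balancedD; apply: balancedZ; apply: balanced_edual; rewrite // unlock.
by move=> l; rewrite !inE => /orP[] /eqP ->; rewrite !edual_tup //=; ring.
Qed.

Lemma balanced_gt4 n (w : form n) : (4 < n)%N -> alternating w -> balanced w ->
  forall z, w z = 0.
Proof.
case: n w => [|[|[|[|[|n]]]]] // w _ w_alt w_bal.
by apply: balanced_ext => //; first exact: alternating0.
Qed.

(** There are only two sets of four arguments to check, and on each the terms
    that survive cancel. *)
Lemma closed_balanced3 (w : form 3) : alternating w -> balanced w ->
  forall z, dl w z = 0.
Proof.
move=> w_alt w_bal; apply: balanced_ext => //;
  [exact: alternating_dl|exact: alternating0|exact: balanced_delta|].
move=> l; rewrite !inE => /orP[] /eqP ->; cbv beta;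
  rewrite delta_tup4 // ?ann_coefE ?ann_mulE /=.
- rewrite [w (tup [:: Lm 1; Lm 1; _])]alternating_dup //=.
  ring.
- rewrite [w (tup [:: _; Nm 0; Nm 0])]alternating_dup //=.
  ring.
Qed.

(** On the sets of three arguments of weight zero, all values of [dl h] are
    multiples of the value of [h] on [L_1, N_0].  That number is zero, as the
    combination vanishes on [L_2, L_0, N_0] whereas [dl h] is -2 times it. *)
Lemma exact_balanced3 (h : form 2) y u v : alternating h ->
    (forall z, y * edual [:: Lm 0; Nm 1; Nm 0] z + (u * edual [:: Lm 1; Lm 0; Nm 1] z +
      v * edual [:: Lm 2; Lm 1; Lm 0] z) = dl h z) ->
  [/\ y = 0, u = 0 & v = 0].
Proof.
move=> h_alt E.
have L2L0N0 := E (tup [:: Lm 2; Lm 0; Nm 0]); have L0N1N0 := E (tup [:: Lm 0; Nm 1; Nm 0]).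
have L1L0N1 := E (tup [:: Lm 1; Lm 0; Nm 1]); have L2L1L0 := E (tup [:: Lm 2; Lm 1; Lm 0]).
move: L2L0N0 L0N1N0 L1L0N1 L2L1L0;
  rewrite !edual_tup // !delta_tup3 // !ann_coefE !ann_mulE /=.
rewrite [h (tup [:: Lm 1; Lm 1])]alternating_dup // [h (tup [:: Nm 0;
  Nm 0])]alternating_dup //.
move=> L2L0N0.
have -> : h (tup [:: Lm 1; Nm 0]) = 0.
  apply: (mulfI two_neq0); transitivity (- (y * 0 + (u * 0 + v * 0))); last by ring.
  by rewrite L2L0N0; ring.
move=> Ey Eu Ev; split; [move: Ey|move: Eu|move: Ev];
  by rewrite !(mulr0, mulr1, addr0, add0r) => ->; ring.
Qed.
End Balanced.

(** * Cochains and their coefficients *)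

Section Substitution.
Variables (K : fieldType) (n : nat).

Definition subst (u : {mpoly K[n]}) : {poly K} -> {mpoly K[n]} :=
  horner_eval u \o map_poly (@mpolyC n K).
HB.instance Definition _ u := GRing.RMorphism.on (subst u).

Lemma substC u c : subst u c%:P = c%:MP.
Proof. by rewrite /subst /= map_polyC /horner_eval hornerC. Qed.

Lemma substX u : subst u 'X = u.
Proof. by rewrite /subst /= map_polyX /horner_eval hornerX. Qed.

Lemma subst_unique (S : comNzRingType) (f g : {rmorphism {poly K} -> S}) :
  (forall c, f c%:P = g c%:P) -> f 'X = g 'X -> f =1 g.
Proof.
move=> fgC fgX; elim/poly_ind => [|p c IH]; first by rewrite !rmorph0.
by rewrite !rmorphD !rmorphM /= IH fgC fgX.
Qed.
End Substitution.

Lemma subst_comp (K : fieldType) n m (u : {mpoly K[n]}) (s : n.-tuple {mpoly K[m]}) p :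
  subst u p \mPo s = subst (u \mPo s) p.
Proof.
apply: (subst_unique (f := comp_mpoly s \o subst u) (g := subst (u \mPo s))) => [c|] /=.
  by rewrite !substC comp_mpolyC.
by rewrite !substX.
Qed.

Section Slotwise.
Variables (K : fieldType) (r n : nat).
Notation A := 'rV[{poly K}]_r.
Notation e l := (delta_mx 0 l : A).
Implicit Types (g h : precochain K r n) (a : {ffun 'I_n -> A}).

(** Multilinearity and sesquilinearity combined into [C[d]]-linearity of each
    slot, with [d] acting as [- lambda_i]; this passes easily to the terms of
    the differential. *)
Definition slotwise g := forall a i x,
  g (upd a i x) = \sum_l subst (- 'X_i) (x 0 l) * g (upd a i (e l)).

Lemma upd_id a i x : upd a i x i = x.
Proof. by rewrite ffunE eqxx. Qed.

Lemma upd_upd a i x y : upd (upd a i x) i y = upd a i y.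
Proof. by apply/ffunP => k; rewrite !ffunE; case: eqP. Qed.

Lemma upd_same a i : upd a i (a i) = a.
Proof. by apply/ffunP => k; rewrite !ffunE; case: eqP => [->|]. Qed.

Lemma slotwise_cochain g : multilinear g -> sesquilinear g -> slotwise g.
Proof.
move=> g_lin g_sesq a i.
have gD c x y : g (upd a i (c%:P *: x + y)) = c *: g (upd a i x) + g (upd a i y) := g_lin a i c x y.
have g0 : g (upd a i 0) = 0.
  have := gD 1 0 0; rewrite scaler0 addr0 scale1r => /eqP.
  by rewrite -subr_eq subrr eq_sym => /eqP.
have gX x : g (upd a i ('X *: x)) = - 'X_i * g (upd a i x).
  by rewrite -g_sesq upd_id upd_upd.
have gZ p x : g (upd a i (p *: x)) = subst (- 'X_i) p * g (upd a i x).
  elim/poly_ind: p => [|p c IH]; first by rewrite scale0r g0 rmorph0 mul0r.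
  rewrite mulrC scalerDl addrC gD -scalerA gX IH rmorphD rmorphM /= substC substX.
  by rewrite mulrDl addrC mulrA mul_mpolyC.
move=> x; rewrite {1}[x]row_sum_delta.
rewrite (big_morph (fun x => g (upd a i x)) (id1 := 0) (op1 := +%R)) //.
  by apply: eq_bigr => l _; rewrite gZ.
by move=> y z; have := gD 1 y z; rewrite !scale1r.
Qed.

Lemma slotwise_ext g h : slotwise g -> slotwise h ->
    (forall t : 'I_n -> 'I_r, g [ffun k => e (t k)] = h [ffun k => e (t k)]) ->
  g = h.
Proof.
move=> g_sl h_sl gh; apply: funext => a.
(* The slots are replaced one at a time; [m] counts those still arbitrary. *)
suff: forall m a, (forall k : 'I_n, (m <= k)%N -> exists l, a k = e l) -> g a = h a.
  by move/(_ n a); apply=> k; rewrite leqNgt ltn_ord.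
elim=> [|m IH] {}a aP.
  have /choice [t at_] : forall k, exists l, a k = e l by move=> k; apply: aP.
  by rewrite (_ : a = [ffun k => e (t k)]) ?gh //; apply/ffunP => k; rewrite ffunE at_.
have [m_n|n_m] := ltnP m n; last first.
  by apply: IH => k mk; apply: aP; have := ltn_ord k; lia.
rewrite -(upd_same a (Ordinal m_n)) g_sl h_sl; apply: eq_bigr => l _; congr (_ * _).
apply: IH => k mk; rewrite ffunE; case: eqP => [_|/eqP km]; first by exists l.
by apply: aP; rewrite ltn_neqAle mk andbT eq_sym; apply: contra km => /eqP E;
  apply/eqP/val_inj.
Qed.

(** The exterior product of the 1-cochains sending the [j]-th generator of
    [z] to a power of [lambda], as given by [z], and the other generators to 0. *)
Definition wedge (z : 'I_n -> 'I_r * nat) : precochain K r n :=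
  fun a => \det (\matrix_(k, j) (subst (- 'X_k) (a k 0 (z j).1) * 'X_k ^+ (z j).2)).

(** The linearity conditions are those of a determinant in its rows, and
    skew-symmetry is its behaviour under row permutations. *)
Lemma is_cochain_wedge z : is_cochain (wedge z).
Proof.
split=> [a i c x y|a i|s a].
- rewrite -mul_mpolyC -[wedge z (upd a i y)]mul1r;
  apply: (determinant_multilinear (i0 := i)).
  + apply/rowP => j; rewrite !mxE !upd_id !mxE rmorphD rmorphM /= substC mul1r.
    by rewrite mulrDl mulrA.
  + by apply/matrixP => k j; rewrite !mxE !ffunE eq_sym (negbTE (neq_lift _ _)).
  + by apply/matrixP => k j; rewrite !mxE !ffunE eq_sym (negbTE (neq_lift _ _)).
- rewrite -[RHS]addr0 -[X in _ + X](mul0r (wedge z a));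
  apply: (determinant_multilinear (i0 := i)).
  + apply/rowP => j; rewrite !mxE !upd_id !mxE rmorphM /= substX mul0r addr0.
    by rewrite mulrA.
  + by apply/matrixP => k j; rewrite !mxE !ffunE eq_sym (negbTE (neq_lift _ _)).
  + by apply/matrixP => k j; rewrite !mxE !ffunE eq_sym (negbTE (neq_lift _ _)).
- rewrite /wedge -det_perm -det_mulmx -row_permE -det_map_mx; congr (\det _).
  apply/matrixP => k j; rewrite !mxE ffunE rmorphM rmorphXn /= subst_comp rmorphN /=.
  by rewrite comp_mpolyXU -tnth_nth tnth_mktuple.
Qed.
End Slotwise.

Section Coefficients.
Variables (K : fieldType) (r : nat).
Hypothesis char0 : [pchar K] =i pred0.
Notation A := 'rV[{poly K}]_r.
Notation Z := ('I_r * nat)%type.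
Notation e l := (delta_mx 0 l : A).

(** Coefficients with respect to divided powers of the variables. *)
Definition taylor n (p : {mpoly K[n]}) (m : 'I_n -> nat) : K :=
  (\prod_k (m k)`!)%:R * p@_[multinom m k | k < n].

Definition coefs n (g : precochain K r n) : form K Z n :=
  fun z => taylor (g [ffun k => e (z k).1]) (fun k => (z k).2).

Lemma prod_fact_neq0 n (m : 'I_n -> nat) : (\prod_k (m k)`!)%:R != 0 :> K.
Proof.
rewrite (pcharf0P _).1 // -lt0n; elim/big_ind: _ => // [x y|k _].
  by rewrite muln_gt0 => -> ->.
exact: fact_gt0.
Qed.

Lemma taylor_inj n (p q : {mpoly K[n]}) : taylor p =1 taylor q -> p = q.
Proof.
move=> pq; apply/mpolyP => m; have := pq m => /(mulfI (prod_fact_neq0 _)).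
by rewrite (_ : [multinom m k | k < n] = m) //; apply/mnmP => k; rewrite mnmE.
Qed.

Lemma coefs_inj n (g h : precochain K r n) : slotwise g -> slotwise h ->
  (forall z, coefs g z = coefs h z) -> g = h.
Proof.
move=> g_sl h_sl gh; apply: slotwise_ext => // t; apply: taylor_inj => m.
exact: gh (fun k => (t k, m k)).
Qed.

Lemma taylorZ n c (p : {mpoly K[n]}) m : taylor (c *: p) m = c * taylor p m.
Proof. by rewrite /taylor mcoeffZ mulrCA. Qed.

Lemma taylorD n (p q : {mpoly K[n]}) m : taylor (p + q) m = taylor p m + taylor q m.
Proof. by rewrite /taylor mcoeffD mulrDr. Qed.

Lemma taylor0 n m : taylor (0 : {mpoly K[n]}) m = 0.
Proof. by rewrite /taylor mcoeff0 mulr0. Qed.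

Lemma taylor_sum n I (s : seq I) (P : pred I) (F : I -> {mpoly K[n]}) m :
  taylor (\sum_(i <- s | P i) F i) m = \sum_(i <- s | P i) taylor (F i) m.
Proof. by elim/big_rec2: _ => [|i x y _ <-]; rewrite ?taylor0 ?taylorD. Qed.

(** In divided powers multiplication by a variable lowers its exponent, as a
    derivation would.  If [m i = 0] the truncated exponent is harmless, since
    the factor [m i] vanishes. *)
Lemma taylorX n i (p : {mpoly K[n]}) m :
  taylor ('X_i * p) m = (m i)%:R * taylor p (fun k => (m k - (k == i))%N).
Proof.
rewrite /taylor mulrC; case mi : (m i) => [|mi'].
  rewrite mul0r; apply/eqP; rewrite mulf_eq0; apply/orP; left.
  rewrite mulrC mcoeff_eq0 (perm_mem (msuppMX _ _)); apply/mapP => -[m' _ /mnmP/(_ i)].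
  by rewrite mnmDE mnmE mi mnm1E eqxx.
have mE : [multinom m k | k < n] = ([multinom (m k - (k == i))%N | k < n] + U_(i))%MM.
  by apply/mnmP => k; rewrite mnmDE !mnmE [i == k]eq_sym; case: eqVneq => [->|_];
    rewrite ?mi; lia.
rewrite mE mulrC ['X_i * p]mulrC addmC mcoeffMX mulrA; congr (_ * _).
rewrite -natrM (bigD1 i) //= [in RHS](bigD1 i) //= eqxx mi subn1 factS -mulnA.
congr (_ * (_ * _))%:R; apply: eq_bigr => k ki.
by rewrite (negbTE ki) subn0.
Qed.

Lemma mpoly_monomial_ind n (P : {mpoly K[n]} -> Prop) :
    (forall c p q, P p -> P q -> P (c *: p + q)) -> P 1 ->
    (forall i p, P p -> P ('X_i * p)) ->
  forall p, P p.
Proof.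
move=> P_lin P1 PX; have P0 : P 0 by rewrite -(addNr 1) -scaleN1r; apply: P_lin.
elim/mpolyind => // c m p _ _ Pp; apply: P_lin => // {c p Pp}.
rewrite mpolyXE_id.
elim: (index_enum _) => [|i s IH]; first by rewrite big_nil.
rewrite big_cons; elim: (m i) => [|k IHk]; first by rewrite expr0 mul1r.
by rewrite exprS -mulrA; apply: PX.
Qed.

Lemma coefs_linear n c (g h : precochain K r n) z :
  coefs (c *: g + h) z = c * coefs g z + coefs h z.
Proof. by rewrite /coefs precochainE taylorD taylorZ. Qed.

Lemma taylor_perm n (s : 'S_n) (p : {mpoly K[n]}) m :
  taylor (p \mPo [tuple 'X_(s k) | k < n]) m = taylor p (m \o s).
Proof.
elim/mpoly_monomial_ind: p m => [c p q Pp Pq m|m|i p Pp m].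
- by rewrite comp_mpolyD comp_mpolyZ !taylorD !taylorZ Pp Pq.
- rewrite comp_mpoly1 /taylor !mcoeff1 [in LHS](reindex_inj (@perm_inj _ s)) /=.
  congr (_ * (nat_of_bool _)%:R); apply/eqP/eqP => /mnmP E; apply/mnmP => k.
    by have := E (s k); rewrite !mnmE.
  by have := E (s^-1%g k); rewrite !mnmE /= permKV.
rewrite rmorphM /= comp_mpolyXU -tnth_nth tnth_mktuple !taylorX Pp; congr (_ * taylor _ _).
by apply: funext => k /=; rewrite (inj_eq perm_inj).
Qed.

Lemma taylor_sign n (b : bool) (p : {mpoly K[n]}) m :
  taylor ((-1) ^+ b * p) m = (-1) ^+ b * taylor p m.
Proof.
by case: b; rewrite ?mul1r // !expr1 !mulN1r -scaleN1r taylorZ mulN1r.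
Qed.

Lemma alternating_coefs n (g : precochain K r n) : skew_symmetric g -> alternating (coefs g).
Proof.
move=> g_skew s z; rewrite /coefs -taylor_sign -g_skew taylor_perm.
by congr (taylor (g _) _); apply/ffunP => k; rewrite !ffunE.
Qed.

Lemma taylor_prod_X n (m m' : 'I_n -> nat) :
  taylor (\prod_k 'X_k ^+ m' k) m = (\prod_k (m' k)`!)%:R * (m == m')%:R.
Proof.
rewrite (_ : \prod_k _ = 'X_[[multinom m' k | k < n]]); last first.
  by rewrite mpolyXE_id; apply: eq_bigr => k _; rewrite mnmE.
rewrite /taylor mcoeffX; have [<-|mm'] := eqVneq m m'; first by rewrite eqxx.
rewrite (_ : _ == _ = false) ?mulr0 //; apply/negP => /eqP/mnmP E.
by case/eqP: mm'; apply: funext => k; have := E k; rewrite !mnmE.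
Qed.

Lemma coefs_wedge n (l : 'I_n -> Z) z :
  coefs (wedge l) z = (\prod_k (l k).2`!)%:R * dual K l z.
Proof.
rewrite dual_sum mulr_sumr /coefs /wedge /determinant taylor_sum.
apply: eq_bigr => s _; rewrite taylor_sign [RHS]mulrCA; congr (_ * _).
rewrite [X in taylor X _](_ : _ =
    ([forall k, (z k).1 == (l (s k)).1])%:R *: \prod_k 'X_k ^+ (l (s k)).2).
  rewrite taylorZ taylor_prod_X [LHS]mulrCA; congr (_%:R * _).
    by rewrite [RHS](reindex_inj (@perm_inj _ s)).
  rewrite -natrM mulnb; congr (nat_of_bool _)%:R; apply/andP/eqP => [[/forallP zl /eqP zm]|->].
    apply: funext => k; have := congr1 (@^~ k) zm; have /eqP := zl k.
    by case: (z k) => g m /=; case: (l (s k)) => g' m' /= -> ->.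
  by split=> //; apply/forallP.
have [/forallP zl|] := boolP [forall k, (z k).1 == (l (s k)).1].
  rewrite scale1r; apply: eq_bigr => k _; rewrite !mxE ffunE !mxE (eqP (zl k)) !eqxx.
  by rewrite rmorph1 mul1r.
rewrite negb_forall => /existsP [k zk]; rewrite scale0r (bigD1 k) //= !mxE ffunE !mxE eqxx.
by rewrite eq_sym (negbTE zk) rmorph0 !mul0r.
Qed.

Definition bounded n (w : form K Z n) :=
  exists N, forall z k, (N <= (z k).2)%N -> w z = 0.

Lemma bounded_coefs n (g : precochain K r n) : bounded (coefs g).
Proof.
exists (\max_(t : {ffun 'I_n -> 'I_r}) msize (g [ffun k => e (t k)])) => z k Nz.
rewrite /coefs /taylor memN_msupp_eq0 ?mulr0 //; apply/negP => /msize_mdeg_lt.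
rewrite ltnNge => /negP; apply.
apply: leq_trans (leq_trans Nz _); last first.
  by rewrite mdegE (bigD1 k) //= mnmE leq_addr.
rewrite (_ : g _ = g [ffun k => e ([ffun k => (z k).1] k)]).
  exact: (leq_bigmax (F := fun t : {ffun 'I_n -> 'I_r} => msize (g [ffun k => e (t k)]))).
by congr g; apply/ffunP => i; rewrite !ffunE.
Qed.

Lemma is_cochain_sum n I (s : seq I) (P : pred I) (c : I -> K) (G : I -> precochain K r n) :
  (forall i, is_cochain (G i)) -> is_cochain (\sum_(i <- s | P i) c i *: G i).
Proof.
move=> G_co; elim/big_ind: _ => [|x y x_co y_co|i _]; first exact: is_cochain0.
  by rewrite -[x]scale1r; apply: is_cochain_linear.
by rewrite -[X in is_cochain X]addr0; apply: is_cochain_linear => //; apply: is_cochain0.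
Qed.

Lemma coefs_sum n I (s : seq I) (P : pred I) (c : I -> K) (G : I -> precochain K r n) z :
  coefs (\sum_(i <- s | P i) c i *: G i) z = \sum_(i <- s | P i) c i * coefs (G i) z.
Proof.
elim/big_rec2: _ => [|i x y _ <-]; first by rewrite /coefs taylor0.
by rewrite coefs_linear.
Qed.

(** A form is, up to the factor [n!], the sum of its values times the dual
    forms, which come from exterior products; boundedness makes the sum
    finite. *)
Lemma cochain_of_form n (w : form K Z n) : alternating w -> bounded w ->
  exists2 h : precochain K r n, is_cochain h & coefs h = w.
Proof.
move=> w_alt [N wN].
pose tuple_of (l : {ffun 'I_n -> 'I_r * 'I_N}) k : Z := ((l k).1, val (l k).2).
have n_neq0 : #|{: 'S_n}|%:R != 0 :> K.
  by rewrite (pcharf0P _).1 // card_Sn -lt0n fact_gt0.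
exists (\sum_l (w (tuple_of l) / (#|{: 'S_n}|%:R * (\prod_k (tuple_of l k).2`!)%:R)) *:
         wedge (tuple_of l)).
  by apply: is_cochain_sum => l; apply: is_cochain_wedge.
apply: funext => z; rewrite coefs_sum.
transitivity (\sum_l \sum_(s : 'S_n) w z / #|{: 'S_n}|%:R * (z == tuple_of l \o s)%:R).
  apply: eq_bigr => l _; rewrite coefs_wedge dual_sum !mulr_sumr; apply: eq_bigr => s _.
  have [->|_] := eqVneq z; last by rewrite !mulr0.
  rewrite w_alt; move: (prod_fact_neq0 (fun k => (tuple_of l k).2)) n_neq0.
  move: ((-1) ^+ s) (_ %:R) (_ %:R) => x y y' y0 y'0.
  by rewrite !mulr1; field; rewrite y0 y'0.
rewrite exchange_big /=.
have [/forallP z_N|] := boolP [forall k, ((z k).2 < N)%N]; last first.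
  rewrite negb_forall => /existsP [k]; rewrite -leqNgt => /wN ->.
  by rewrite big1 // => s _; rewrite big1 // => l _; rewrite !mul0r.
transitivity (\sum_(s : 'S_n) w z / #|{: 'S_n}|%:R).
  apply: eq_bigr => s _; pose l0 := [ffun k => ((z (s^-1%g k)).1, Ordinal (z_N (s^-1%g k)))].
  rewrite (bigD1 l0) //= big1 ?addr0 => [|l ll0].
    rewrite (_ : z == _) ?mulr1 //; apply/eqP/funext => k.
    by rewrite /tuple_of /= ffunE /= permK -surjective_pairing.
  rewrite (_ : z == _ = false) ?mulr0 //; apply: contraNF ll0 => /eqP zl.
  apply/eqP/ffunP => k; rewrite ffunE.
  have := congr1 (@^~ (s^-1%g k)) zl; rewrite /tuple_of /= permKV; case: (l k) => g m zk.
  by congr pair; [rewrite zk|apply: val_inj; rewrite /= zk].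
by rewrite sumr_const -[LHS]mulr_natr; apply: (divfK n_neq0).
Qed.
End Coefficients.

(** * The differential on coefficients *)

Lemma lift_inord n (i j : 'I_n.+2) : (i < j)%N -> lift j (inord i : 'I_n.+1) = i.
Proof.
by move=> ij; apply: val_inj; rewrite /= /bump inordK; have := ltn_ord j; lia.
Qed.

Lemma skip2_neql n (i j : 'I_n.+2) k : (i < j)%N -> skip2 i j k != i.
Proof.
by move=> ij; rewrite -[X in _ != X](lift_inord ij) (inj_eq lift_inj) eq_sym neq_lift.
Qed.

Lemma skip2_neqr n (i j : 'I_n.+2) k : skip2 i j k != j.
Proof. by rewrite eq_sym neq_lift. Qed.

Lemma skip2_inj n (i j : 'I_n.+2) : injective (skip2 i j).
Proof. by move=> k k' /lift_inj /lift_inj. Qed.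

Variant skip2_spec n (i j : 'I_n.+2) (k : 'I_n.+2) : Prop :=
  | Skip2i of k = i | Skip2j of k = j | Skip2 k' of k = skip2 i j k'.

Lemma skip2P n (i j k : 'I_n.+2) : (i < j)%N -> skip2_spec i j k.
Proof.
move=> ij; case: (unliftP j k) => [k1|] ->; last exact: Skip2j.
case: (unliftP (inord i) k1) => [k2|] ->; last by apply: Skip2i; rewrite lift_inord.
exact: (Skip2 (k' := k2)).
Qed.

Section Evaluation.
Variables (K : fieldType) (n : nat).

(** Evaluation at [lambda = lambda_i], [d = - lambda_i - lambda_j]: in the
    differential, the [d] of a bracket is absorbed by a slot with variable
    [lambda_i + lambda_j]. *)
Definition ev (i j : 'I_n) : {poly {poly K}} -> {mpoly K[n]} :=
  horner_eval 'X_i \o map_poly (subst (- ('X_i + 'X_j))).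
HB.instance Definition _ i j := GRing.RMorphism.on (ev i j).

Lemma evC i j p : ev i j p%:P = subst (- ('X_i + 'X_j)) p.
Proof. by rewrite /ev /= map_polyC /horner_eval hornerC. Qed.

Lemma evX i j : ev i j 'X = 'X_i.
Proof. by rewrite /ev /= map_polyX /horner_eval hornerX. Qed.

Lemma evM i j p q : ev i j (p * q) = ev i j p * ev i j q.
Proof. exact: rmorphM. Qed.

Lemma evD i j p q : ev i j (p + q) = ev i j p + ev i j q.
Proof. exact: rmorphD. Qed.

Lemma evN i j p : ev i j (- p) = - ev i j p.
Proof. exact: rmorphN. Qed.

Lemma ev_wide i j N (p : {poly {poly K}}) : (size p <= N)%N ->
  ev i j p = \sum_(m < N) 'X_i ^+ m * subst (- ('X_i + 'X_j)) p`_m.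
Proof.
move=> pN; rewrite /ev /= /horner_eval (horner_coef_wide (n := N)).
  by apply: eq_bigr => m _; rewrite coef_map mulrC.
exact: leq_trans (size_poly _ _) pN.
Qed.

Lemma ev_comp i j (p : {poly K}) u : ev i j (map_poly polyC p \Po u) = subst (ev i j u) p.
Proof.
elim/poly_ind: p => [|p c IH]; first by rewrite !(rmorph0, comp_poly0).
rewrite rmorphD rmorphM /= map_polyX map_polyC comp_polyD comp_polyM comp_polyX comp_polyC.
by rewrite !rmorphD !rmorphM /= IH substX evC !substC.
Qed.
End Evaluation.

Section DifferentialExpansion.
Variables (K : fieldType) (r : nat).
Notation A := 'rV[{poly K}]_r.
Notation e l := (delta_mx 0 l : A).

(** The substitution of variables in the [(i, j)] term of the differential. *)
Definition merge p (i j : 'I_p.+2) : p.+1.-tuple {mpoly K[p.+2]} :=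
  [tuple fcons ('X_i + 'X_j) (fun l : 'I_p => 'X_(skip2 i j l)) k | k < p.+1].

Lemma merge0 p (i j : 'I_p.+2) : tnth (merge i j) ord0 = 'X_i + 'X_j.
Proof. by rewrite tnth_mktuple fcons0. Qed.

Lemma mergeS p (i j : 'I_p.+2) k : tnth (merge i j) (lift ord0 k) = 'X_(skip2 i j k).
Proof. by rewrite tnth_mktuple fconsS. Qed.

Lemma finfun_fcons p (x x' : A) (y : 'I_p -> A) :
  finfun (fcons x y) = upd (finfun (fcons x' y)) ord0 x.
Proof.
apply/ffunP => k; rewrite !ffunE; case: (unliftP ord0 k) => [l|] ->.
  by rewrite !fconsS.
by rewrite fcons0 eqxx.
Qed.

Lemma slotwise_fcons p (g : precochain K r p.+1) x y : slotwise g ->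
  g (finfun (fcons x y)) =
  \sum_l subst (- 'X_ord0) (x 0 l) * g (finfun (fcons (e l) y)).
Proof.
move=> g_sl; rewrite (finfun_fcons x 0) g_sl; apply: eq_bigr => l _.
by rewrite -finfun_fcons.
Qed.

Variable br : A -> A -> 'rV[{poly {poly K}}]_r.

Definition diff_term p (g : precochain K r p.+1) (i j : 'I_p.+2) (x y : A) (z : 'I_p -> A) :=
  \sum_l ev i j (br x y 0 l) * (g (finfun (fcons (e l) z)) \mPo merge i j).

(** Sesquilinearity in the slot of the bracket replaces its expansion in powers
    of [lambda] by an evaluation. *)
Lemma diff_expand p (g : precochain K r p.+1) a : slotwise g ->
  diff br g a = \sum_(i < p.+2) \sum_(j < p.+2 | (i < j)%N)
    (-1) ^+ (i + j) * diff_term g i j (a i) (a j) (fun k => a (skip2 i j k)).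
Proof.
move=> g_sl /=; apply: eq_bigr => i _; apply: eq_bigr => j _; congr (_ * _).
set v := br _ _; pose z (k : 'I_p) := a (skip2 i j k); rewrite -/z.
rewrite /diff_term -/v.
transitivity (\sum_(m < lambda_size v) \sum_l 'X_i ^+ m * (subst (- ('X_i + 'X_j)) (v 0 l)`_m *
    (g (finfun (fcons (e l) z)) \mPo merge i j))).
  apply: eq_bigr => m _; rewrite slotwise_fcons // raddf_sum mulr_sumr; apply: eq_bigr => l _.
  rewrite [LHS]/= -/(merge i j) rmorphM /= subst_comp rmorphN /= comp_mpolyXU -tnth_nth merge0.
  by rewrite /lambda_coef mxE.
rewrite exchange_big; apply: eq_bigr => l _; rewrite (ev_wide i j (N := lambda_size v)).
  by rewrite mulr_suml; apply: eq_bigr => m _; rewrite mulrA.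
exact: (leq_bigmax (F := fun l => size (v 0 l))).
Qed.
End DifferentialExpansion.

Section Sesqui.
Variables (K : fieldType) (r n : nat) (u v : {mpoly K[n]}) (F : 'I_r -> 'I_r -> {mpoly K[n]}).
Notation A := 'rV[{poly K}]_r.
Notation e l := (delta_mx 0 l : A).

Definition sesqui (x y : A) :=
  \sum_p \sum_q subst u (x 0 p) * subst v (y 0 q) * F p q.

Lemma sesqui_gen p q : sesqui (e p) (e q) = F p q.
Proof.
rewrite /sesqui (bigD1 p) //= (bigD1 q) //= !mxE !eqxx !rmorph1 !mul1r.
rewrite !big1 ?addr0 // => [p' p'p|q' q'q].
  by rewrite big1 // => q' _; rewrite !mxE eqxx (negbTE p'p) rmorph0 !mul0r.
by rewrite !mxE eqxx (negbTE q'q) rmorph0 mulr0 mul0r.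
Qed.

Lemma sesqui_l x y : sesqui x y = \sum_p subst u (x 0 p) * sesqui (e p) y.
Proof.
apply: eq_bigr => p _; rewrite [sesqui _ _](bigD1 p) //= mulrDr.
rewrite [X in _ + _ * X]big1 ?mulr0 ?addr0 => [|p' p'p].
  rewrite mulr_sumr; apply: eq_bigr => q _.
  by rewrite !mxE !eqxx rmorph1 mul1r mulrA.
by rewrite big1 // => q _; rewrite !mxE eqxx (negbTE p'p) rmorph0 !mul0r.
Qed.

Lemma sesqui_r x y : sesqui x y = \sum_q subst v (y 0 q) * sesqui x (e q).
Proof.
rewrite /sesqui exchange_big; apply: eq_bigr => q _.
rewrite [X in _ = _ * X]exchange_big [X in _ = _ * X](bigD1 q) //= mulrDr.
rewrite [X in _ + _ * X]big1 ?mulr0 ?addr0 => [|q' q'q].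
  rewrite mulr_sumr; apply: eq_bigr => p _.
  by rewrite !mxE !eqxx rmorph1; ring.
by rewrite big1 // => p _; rewrite !mxE eqxx (negbTE q'q) rmorph0 mulr0 mul0r.
Qed.
End Sesqui.

Section GeneratorBrackets.
Variable K : fieldType.
Hypothesis char0 : [pchar K] =i pred0.

Definition lin_poly (t : K * K * K) : {poly {poly K}} :=
  t.1.1%:P%:P * 'X + t.1.2%:P%:P * (- 'X - 'X%:P) + t.2%:P%:P.

Lemma sv_table_lin (p q l : 'I_4) : (p <= q)%N ->
  sv_table K p q 0 l = (l == br_gen p q)%:R * lin_poly (br_coef K p q).
Proof.
have E32 : 3%:R / 2%:R = 2%:R^-1 + 1 :> K.
  have two0 : 2%:R != 0 :> K by rewrite (pcharf0P _).1.
  by field.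
case: p => [[|[|[|[|//]]]] ip]; case: q => [[|[|[|[|//]]]] iq] //= _;
  rewrite /sv_table /br_gen /br_coef /lin_poly /= ?mxE /= -?val_eqE /=.
all: rewrite ?E32.
all: ring.
Qed.

(** The substitution [lambda -> - lambda - d] of skew-symmetry exchanges the two
    linear forms. *)
Lemma lin_poly_comp a b c : lin_poly (a, b, c) \Po (- 'X - 'X%:P) = lin_poly (b, a, c).
Proof.
rewrite /lin_poly /=; set q := - 'X - 'X%:P.
rewrite !(comp_polyD, comp_polyM, comp_polyX, comp_polyC) /q.
rewrite !raddfN /= comp_polyX comp_polyC; ring.
Qed.

Lemma sv_gen_lin (p q l : 'I_4) :
  sv_gen K p q 0 l = (l == br_gen p q)%:R * lin_poly (br_coef K p q).
Proof.
rewrite /sv_gen; case: ifP => [/sv_table_lin -> //|/negbT]; rewrite -ltnNge => /ltnW qp.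
rewrite !mxE sv_table_lin // comp_polyM [br_coef K q p]surjective_pairing.
rewrite [(br_coef K q p).1]surjective_pairing lin_poly_comp.
have -> : (l == br_gen q p)%:R \Po (- 'X - 'X%:P) = (l == br_gen q p)%:R :> {poly {poly K}}.
  by case: (l == _); rewrite ?comp_polyC ?rmorph1 ?comp_poly0.
case: p qp => [[|[|[|[|//]]]] ip]; case: q => [[|[|[|[|//]]]] iq] //= _;
  rewrite /br_gen /br_coef /lin_poly /= -?val_eqE /=.
all: ring.
Qed.
End GeneratorBrackets.

Section SVBracket.
Variable K : fieldType.
Hypothesis char0 : [pchar K] =i pred0.
Notation A := 'rV[{poly K}]_4.
Notation e l := (delta_mx 0 l : A).
Notation br := (@sv_bracket K).

Arguments sv_gen : simpl never.
Arguments sv_bracket : simpl never.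

Lemma ev_sv_bracket n (i j : 'I_n) (x y : A) l :
  ev i j (br x y 0 l) = sesqui (- 'X_i) (- 'X_j) (fun p q => ev i j (sv_gen K p q 0 l)) x y.
Proof.
rewrite /sv_bracket summxE rmorph_sum; apply: eq_bigr => p _.
rewrite summxE rmorph_sum; apply: eq_bigr => q _.
transitivity (ev i j ((map_poly polyC (x 0 p) \Po (- 'X)) *
    (map_poly polyC (y 0 q) \Po ('X%:P + 'X)) * sv_gen K p q 0 l)); first by rewrite mxE.
rewrite !evM !ev_comp evN evD evC evX substX; congr (_ * subst _ _ * _).
ring.
Qed.

Lemma ev_sv_bracket_gen n (i j : 'I_n) p q l :
  ev i j (br (e p) (e q) 0 l) = ev i j (sv_gen K p q 0 l).
Proof. by rewrite ev_sv_bracket sesqui_gen. Qed.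

Lemma ev_sv_bracketl n (i j : 'I_n) (x y : A) l :
  ev i j (br x y 0 l) = \sum_p subst (- 'X_i) (x 0 p) * ev i j (br (e p) y 0 l).
Proof.
apply: etrans (ev_sv_bracket _ _ _ _ _) (etrans (sesqui_l _ _ _ _ _) _).
by apply: eq_bigr => p _; congr (_ * _); apply: esym (ev_sv_bracket _ _ _ _ _).
Qed.

Lemma ev_sv_bracketr n (i j : 'I_n) (x y : A) l :
  ev i j (br x y 0 l) = \sum_q subst (- 'X_j) (y 0 q) * ev i j (br x (e q) 0 l).
Proof.
apply: etrans (ev_sv_bracket _ _ _ _ _) (etrans (sesqui_r _ _ _ _ _) _).
by apply: eq_bigr => p _; congr (_ * _); apply: esym (ev_sv_bracket _ _ _ _ _).
Qed.

Lemma ev_sv_gen n (i j : 'I_n) p q l : let t := br_coef K p q in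
  ev i j (sv_gen K p q 0 l) = (l == br_gen p q)%:R *
    (t.1.1 *: 'X_i + t.1.2 *: 'X_j + t.2%:MP).
Proof.
rewrite /= sv_gen_lin // evM; congr (_ * _); first by case: (_ == _); rewrite ?rmorph1 ?rmorph0.
rewrite /lin_poly !evD !evM evD !evN !evC evX substX !substC -!mul_mpolyC; ring.
Qed.

Lemma diff_sv_gens p (g : precochain K 4 p.+1) (t : 'I_p.+2 -> 'I_4) : slotwise g ->
  diff br g [ffun k => e (t k)] = \sum_(i < p.+2) \sum_(j < p.+2 | (i < j)%N)
   (-1) ^+ (i + j) * (let c := br_coef K (t i) (t j) in
     (c.1.1 *: 'X_i + c.1.2 *: 'X_j + c.2%:MP) *
     (g [ffun k => e (fcons (br_gen (t i) (t j)) (t \o skip2 i j) k)] \mPo merge K i j)).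
Proof.
move=> g_sl; rewrite diff_expand //; apply: eq_bigr => i _; apply: eq_bigr => j _.
congr (_ * _); rewrite /diff_term !ffunE (bigD1 (br_gen (t i) (t j))) //= big1 ?addr0.
  rewrite ev_sv_bracket_gen ev_sv_gen eqxx mul1r; congr (_ * (g _ \mPo _)).
  apply/ffunP => k; rewrite !ffunE; case: (unliftP ord0 k) => [k'|] ->.
    by rewrite !fconsS ffunE.
  by rewrite !fcons0.
move=> l /negbTE lg; by rewrite ev_sv_bracket_gen ev_sv_gen lg !mul0r.
Qed.

Lemma merge_shift p (i j l : 'I_p.+2) (m : 'I_p.+2 -> nat) : (i < j)%N ->
    (l == i) || (l == j) -> (0 < m l)%N ->
  fcons ((m i - (i == l)) + (m j - (j == l)))%N
    ((fun k => (m k - (k == l))%N) \o skip2 i j) = fcons (m i + m j).-1 (m \o skip2 i j).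
Proof.
move=> ij; have ji : (j == i) = false by rewrite -val_eqE /= gtn_eqF.
case/orP => /eqP -> ml; apply: fconsP => [|k']; rewrite ?fcons0 ?fconsS /= ?eqxx.
- by rewrite ji; lia.
- by rewrite (negbTE (skip2_neql _ ij)) subn0.
- by rewrite [i == j]eq_sym ji; lia.
- by rewrite (negbTE (skip2_neqr _ _ _)) subn0.
Qed.

(** In divided powers the binomial coefficients in the expansion of a power of
    [lambda_i + lambda_j] disappear. *)
Lemma taylor_merge p (i j : 'I_p.+2) (q : {mpoly K[p.+1]}) m : (i < j)%N ->
  taylor (q \mPo merge K i j) m = taylor q (fcons (m i + m j)%N (m \o skip2 i j)).
Proof.
move=> ij; elim/mpoly_monomial_ind: q m => [c q q' IHq IHq' m|m|k q IH m].
- by rewrite comp_mpolyD comp_mpolyZ !taylorD !taylorZ IHq IHq'.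
- rewrite comp_mpoly1.
  have E : \prod_k 'X_k ^+ 0 = 1 :> {mpoly K[p.+2]} by rewrite big1.
  have E' : \prod_k 'X_k ^+ 0 = 1 :> {mpoly K[p.+1]} by rewrite big1.
  rewrite -{1}E -E' !taylor_prod_X !big1 //; congr (_ * (nat_of_bool _)%:R).
  apply/eqP/eqP => [->|E0].
    by apply: fconsP => [|k]; rewrite ?fcons0 ?fconsS.
  have m_skip k : m (skip2 i j k) = 0%N.
    by have := congr1 (@^~ (lift ord0 k)) E0; rewrite /= fconsS.
  have /eqP := congr1 (@^~ ord0) E0; rewrite /= fcons0 addn_eq0 => /andP[/eqP mi /eqP mj].
  apply: funext => k; have [->|->|k' ->] // := skip2P k ij.
rewrite rmorphM /= comp_mpolyXU -tnth_nth taylorX; case: (unliftP ord0 k) => [k'|] ->.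
  rewrite mergeS taylorX IH fconsS; congr (_ * taylor _ _).
  apply: fconsP => [|l]; rewrite ?fcons0 ?fconsS /=.
    rewrite ![_ == skip2 i j k']eq_sym (negbTE (skip2_neql _ ij)).
    by rewrite (negbTE (skip2_neqr _ _ _)) !subn0.
  by rewrite (inj_eq (@skip2_inj _ _ _)) (inj_eq lift_inj).
rewrite merge0 mulrDl taylorD !taylorX !IH fcons0 natrD mulrDl.
have E : (fun k : 'I_p.+1 => (fcons (m i + m j) (m \o skip2 i j) k - (k == ord0))%N) =
         fcons (m i + m j).-1 (m \o skip2 i j).
  by apply: fconsP => [|k']; rewrite ?fcons0 ?fconsS ?subn1 ?subn0.
rewrite E; apply: congr2.
  case mi : (m i) => [|mi']; first by rewrite !mul0r.
  by rewrite -mi merge_shift ?eqxx ?mi.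
case mj : (m j) => [|mj']; first by rewrite !mul0r.
by rewrite -mj merge_shift ?eqxx ?orbT ?mj.
Qed.

Lemma br_coef_deg p q :
  (br_deg p q = 1%N /\ (br_coef K p q).2 = 0) \/
  [/\ br_deg p q = 0%N, (br_coef K p q).1.1 = 0 & (br_coef K p q).1.2 = 0].
Proof.
case: p => [[|[|[|[|//]]]] ip]; case: q => [[|[|[|[|//]]]] iq];
  by rewrite /br_deg /br_coef /=; auto using And3.
Qed.

Lemma taylor_lin p (i j : 'I_p) (t : K * K * K) (q : {mpoly K[p]}) m :
  taylor ((t.1.1 *: 'X_i + t.1.2 *: 'X_j + t.2%:MP) * q) m =
  t.1.1 * ((m i)%:R * taylor q (fun k => m k - (k == i))%N) +
  t.1.2 * ((m j)%:R * taylor q (fun k => m k - (k == j))%N) + t.2 * taylor q m.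
Proof.
by rewrite !mulrDl mul_mpolyC -!scalerAl !taylorD !taylorZ !taylorX.
Qed.

(** A factor [lambda_i] of a bracket lowers an exponent by [taylorX] and
    contributes [m_i], whence the structure constants of the annihilation
    algebra. *)
Lemma coefs_diff n (g : precochain K 4 n) z : slotwise g ->
  coefs (diff br g) z = delta (@ann_coef K) ann_mul (coefs g) z.
Proof.
case: n g z => [|p] g z g_sl; first by rewrite /coefs /= taylor0.
rewrite {1}/coefs (diff_sv_gens (fun k => (z k).1) g_sl) taylor_sum.
apply: eq_bigr => i _; rewrite taylor_sum; apply: eq_bigr => j ij.
rewrite -(signr_odd _ (i + j)) -(signr_odd _ (i + j)) taylor_sign; congr (_ * _).
rewrite taylor_lin !taylor_merge //.
have shift l (q : {mpoly K[p.+1]}) : (l == i) || (l == j) -> (z l).2%:R * taylor q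
    (fcons ((z i).2 - (i == l) + ((z j).2 - (j == l)))%N
       ((fun k => ((z k).2 - (k == l))%N) \o skip2 i j)) =
    (z l).2%:R * taylor q (fcons ((z i).2 + (z j).2).-1 ((fun k => (z k).2) \o skip2 i j)).
  move=> lij; case ml : ((z l).2) => [|ml']; first by rewrite !mul0r.
  by rewrite (merge_shift (m := fun k => (z k).2)) ?ml.
rewrite !shift ?eqxx ?orbT // /coefs /ann_coef /=.
rewrite [X in _ = _ * taylor (g X) _](_ : _ = [ffun k => e (fcons (br_gen (z i).1 (z j).1)
   ((fun k => (z k).1) \o skip2 i j) k)]); last first.
  by apply/ffunP => k; rewrite !ffunE; case: (unliftP ord0 k) => [k'|] ->;
    rewrite ?fcons0 ?fconsS.
rewrite [X in _ = _ * taylor _ X](_ : _ = fcons ((z i).2 + (z j).2 - br_deg (z i).1 (z j).1)%N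
    ((fun k => (z k).2) \o skip2 i j)); last first.
  by apply: fconsP => [|k]; rewrite ?fcons0 ?fconsS.
have [[-> ->]|[-> -> ->]] := br_coef_deg (z i).1 (z j).1.
  by rewrite subn1; ring.
by rewrite subn0; ring.
Qed.
End SVBracket.

Section DiffSlotwise.
Variables (K : fieldType) (r : nat).
Notation A := 'rV[{poly K}]_r.
Notation e l := (delta_mx 0 l : A).
Variable br : A -> A -> 'rV[{poly {poly K}}]_r.

(** Sesquilinearity of the bracket, as seen by the evaluations. *)
Hypothesis br_l : forall n (i j : 'I_n) x y l,
  ev i j (br x y 0 l) = \sum_p subst (- 'X_i) (x 0 p) * ev i j (br (e p) y 0 l).
Hypothesis br_r : forall n (i j : 'I_n) x y l,
  ev i j (br x y 0 l) = \sum_p subst (- 'X_j) (y 0 p) * ev i j (br x (e p) 0 l).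

Section Term.
Variables (p : nat) (g : precochain K r p.+1) (i j : 'I_p.+2).

Lemma diff_terml (x y : A) z : diff_term br g i j x y z =
  \sum_l subst (- 'X_i) (x 0 l) * diff_term br g i j (e l) y z.
Proof.
under [RHS]eq_bigr => l _ do rewrite mulr_sumr.
rewrite exchange_big; apply: eq_bigr => l _; rewrite br_l mulr_suml.
by apply: eq_bigr => q _; rewrite mulrA.
Qed.

Lemma diff_termr (x y : A) z : diff_term br g i j x y z =
  \sum_l subst (- 'X_j) (y 0 l) * diff_term br g i j x (e l) z.
Proof.
under [RHS]eq_bigr => l _ do rewrite mulr_sumr.
rewrite exchange_big; apply: eq_bigr => l _; rewrite br_r mulr_suml.
by apply: eq_bigr => q _; rewrite mulrA.
Qed.

Lemma diff_term_slot (x y : A) z k u : slotwise g ->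
  diff_term br g i j x y (replace z k u) =
  \sum_l subst (- 'X_(skip2 i j k)) (u 0 l) * diff_term br g i j x y (replace z k (e l)).
Proof.
move=> g_sl; under [RHS]eq_bigr => l _ do rewrite mulr_sumr.
rewrite exchange_big; apply: eq_bigr => q _; move: (ev i j _) => c.
have upd_fcons v : finfun (fcons (e q) (replace z k v)) =
    upd (finfun (fcons (e q) z)) (lift ord0 k) v.
  apply/ffunP => k'; rewrite !ffunE; case: (unliftP ord0 k') => [l|] ->.
    by rewrite !fconsS /replace (inj_eq lift_inj).
  by rewrite !fcons0.
rewrite upd_fcons g_sl raddf_sum mulr_sumr; apply: eq_bigr => l _.
rewrite [X in _ * X = _]/= rmorphM /= subst_comp rmorphN /= comp_mpolyXU -tnth_nth mergeS.
by rewrite upd_fcons mulrCA.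
Qed.
End Term.

(** A slot of the differential is, in the [(i, j)] term, the left or right entry
    of the bracket or a slot of [g]. *)
Lemma slotwise_diff n (g : precochain K r n) : slotwise g -> slotwise (diff br g).
Proof.
case: n g => [|p] g g_sl a s x; first by rewrite /= big1 // => l _; rewrite mulr0.
under [RHS]eq_bigr => l _ do rewrite diff_expand // mulr_sumr.
rewrite diff_expand // exchange_big; apply: eq_bigr => i _.
under [RHS]eq_bigr => l _ do rewrite mulr_sumr.
rewrite exchange_big; apply: eq_bigr => j ij.
under [RHS]eq_bigr => l _ do rewrite mulrCA.
rewrite -mulr_sumr; congr (_ * _).
have skip_upd v : s = i \/ s = j -> (fun k => upd a s v (skip2 i j k)) = (fun k => a (skip2 i j k)).
  case=> ->; apply: funext => k; rewrite ffunE; first by rewrite (negbTE (skip2_neql _ ij)).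
  by rewrite (negbTE (skip2_neqr _ _ _)).
have ji : (j == i) = false by rewrite -val_eqE /= gtn_eqF.
have [si|sj|k sk] := skip2P s ij.
- have termE v : diff_term br g i j (upd a s v i) (upd a s v j) (fun k => upd a s v (skip2 i j k))
      = diff_term br g i j v (a j) (fun k => a (skip2 i j k)).
    by rewrite skip_upd; [rewrite si !ffunE eqxx ji|left].
  by rewrite termE diff_terml; apply: eq_bigr => l _; rewrite termE si.
- have termE v : diff_term br g i j (upd a s v i) (upd a s v j) (fun k => upd a s v (skip2 i j k))
      = diff_term br g i j (a i) v (fun k => a (skip2 i j k)).
    by rewrite skip_upd; [rewrite sj !ffunE eqxx eq_sym ji|right].
  by rewrite termE diff_termr; apply: eq_bigr => l _; rewrite termE sj.
have termE v : diff_term br g i j (upd a s v i) (upd a s v j) (fun k => upd a s v (skip2 i j k))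
    = diff_term br g i j (a i) (a j) (replace (fun k => a (skip2 i j k)) k v).
  rewrite sk !ffunE eq_sym (negbTE (skip2_neql _ ij)) eq_sym (negbTE (skip2_neqr _ _ _)).
  by congr (diff_term _ _ _ _ _ _ _); apply: funext => k';
    rewrite ffunE (inj_eq (@skip2_inj _ _ _)).
apply: etrans (termE x) (etrans (diff_term_slot _ _ _ _ _ _ _ g_sl) _).
by apply: eq_bigr => l _; congr (_ * _); [rewrite sk|apply: esym (termE _)].
Qed.
End DiffSlotwise.

(** * Spanning and independence of the classes *)

Section BasisOfClasses.
Variables (K : fieldType) (r : nat).
Variable (br : 'rV[{poly K}]_r -> 'rV[{poly K}]_r -> 'rV[{poly {poly K}}]_r).
Variable q : nat.

Lemma coh_class_eq (g h : cocycle br q) :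
  coh_class g = coh_class h <-> is_coboundary br (val g - val h).
Proof.
rewrite /coh_class quot_class_eq; split=> [/asboolP|gh]; first by rewrite raddfB.
by apply/asboolP; rewrite raddfB.
Qed.

Lemma coh_classD (g h : cocycle br q) : coh_class (g + h) = coh_class g + coh_class h.
Proof. exact: quot_classD. Qed.

Lemma coh_classZ c (g : cocycle br q) : coh_class (c *: g) = c *: coh_class g.
Proof. exact: esym (quot_classZ _ _ _). Qed.

Lemma coh_class0 : coh_class (0 : cocycle br q) = 0.
Proof. by rewrite -(scale0r 0) coh_classZ scale0r. Qed.

Lemma coh_class_sum n (c : 'rV[K]_n) (b : 'I_n -> cocycle br q) :
  coh_class (\sum_i c 0 i *: b i) = \sum_i c 0 i *: coh_class (b i).
Proof.
elim/big_rec2: _ => [|i x y _ <-]; first exact: coh_class0.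
by rewrite coh_classD coh_classZ.
Qed.

Lemma is_basis_coh_class n (b : 'I_n -> cocycle br q) (B : n.-tuple (cohomology br q)) :
    (forall i, tnth B i = coh_class (b i)) ->
    (forall g : cocycle br q, exists c : 'rV[K]_n,
       is_coboundary br (val g - \sum_i c 0 i *: val (b i))) ->
    (forall c : 'rV[K]_n, is_coboundary br (\sum_i c 0 i *: val (b i)) -> c = 0) ->
  is_basis B.
Proof.
move=> Bb b_span b_free v; have [g ->] := quot_classP v.
have valE (c : 'rV[K]_n) : val (\sum_i c 0 i *: b i) = \sum_i c 0 i *: val (b i).
  by elim/big_rec2: _ => [|i x y _ <-]; rewrite ?linear0 ?linearP.
have BE (c : 'rV[K]_n) : \sum_i c 0 i *: tnth B i = coh_class (\sum_i c 0 i *: b i).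
  by rewrite coh_class_sum; apply: eq_bigr => i _; rewrite Bb.
have [c gc] := b_span g; exists c; split.
  by rewrite BE; apply/coh_class_eq; rewrite valE.
move=> c' Ec'; apply/eqP; rewrite -subr_eq0; apply/eqP/b_free.
have : coh_class (\sum_i c 0 i *: b i) = coh_class (\sum_i c' 0 i *: b i).
  rewrite -!BE -Ec' BE; apply/esym/coh_class_eq; by rewrite valE.
move/coh_class_eq; rewrite !valE; congr is_coboundary.
by rewrite -sumrB; apply: eq_bigr => i _; rewrite !mxE scalerBl.
Qed.
End BasisOfClasses.

Section SVCochains.
Variable K : fieldType.
Hypothesis char0 : [pchar K] =i pred0.
Notation Z := ('I_4 * nat)%type.
Notation br := (@sv_bracket K).
Notation dl := (delta (@ann_coef K) ann_mul).

Lemma slotwise_of_cochain n (g : precochain K 4 n) : is_cochain g -> slotwise g.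
Proof. by case=> g1 g2 _; apply: slotwise_cochain. Qed.

Lemma slotwise_diff_sv n (g : precochain K 4 n) : is_cochain g -> slotwise (diff br g).
Proof.
move=> g_co; apply: slotwise_diff; last exact: slotwise_of_cochain.
  exact: ev_sv_bracketl.
exact: ev_sv_bracketr.
Qed.

Lemma coefs_diff_sv n (g : precochain K 4 n) : is_cochain g ->
  forall z, coefs (diff br g) z = dl (coefs g) z.
Proof. by move=> g_co z; apply: coefs_diff => //; apply: slotwise_of_cochain. Qed.

Lemma alternating_coefs_cochain n (g : precochain K 4 n) : is_cochain g -> alternating (coefs g).
Proof. by case=> _ _; apply: alternating_coefs. Qed.

Lemma coefs0 n z : coefs (0 : precochain K 4 n) z = 0.
Proof. by rewrite /coefs taylor0. Qed.

Lemma slotwise0 n : slotwise (0 : precochain K 4 n).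
Proof. exact: slotwise_of_cochain (is_cochain0 _ _ _). Qed.

Lemma diff_eq0 n (g : precochain K 4 n) : is_cochain g ->
  diff br g = 0 <-> forall z, dl (coefs g) z = 0.
Proof.
move=> g_co; split=> [dg z|dg]; first by rewrite -coefs_diff_sv // dg coefs0.
apply: (coefs_inj char0); [exact: slotwise_diff_sv|exact: slotwise0|].
by move=> z; rewrite coefs_diff_sv // dg coefs0.
Qed.

(** In degree 3 by computation, in higher degrees because the differential
    would have weight zero in a degree above 4. *)
Lemma is_cocycle_balanced n (g : precochain K 4 n) : is_cochain g -> (2 < n)%N ->
  balanced (coefs g) -> g \in is_cocycle br (n := n).
Proof.
move=> g_co n2 g_bal; apply/asboolP; split=> //; apply/diff_eq0 => //.
have g_alt := alternating_coefs_cochain g_co.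
case: n n2 g g_co g_bal g_alt => [|[|[|[|n]]]] // _ g g_co g_bal g_alt.
  exact: closed_balanced3.
apply: balanced_gt4 => //; [exact: alternating_dl|exact: balanced_delta].
Qed.

Lemma bounded_primitive n (w : form K Z n.+1) : bounded w ->
  bounded (primitive ann_wt (Lm 1) (Nm 0) (- (5%:R / 2%:R)) w).
Proof.
case=> N wN; exists N => z k Nz; rewrite /primitive /contract_euler /contract.
by rewrite !(wN _ (lift ord0 k)) ?fconsS // !mulr0 addr0.
Qed.

(** The primitive of the part of nonzero weight has bounded exponents, so it
    does come from a cochain. *)
Lemma cocycle_balanced n (g : precochain K 4 n.+1) : g \in is_cocycle br (n := n.+1) ->
  exists2 h : precochain K 4 n, is_cochain h &
    forall z, coefs g z = balanced_part ann_wt (coefs g) z + coefs (diff br h) z.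
Proof.
move=> /asboolP [g_co g_closed]; have /diff_eq0 := g_closed => /(_ g_co) w_closed.
have w_alt := alternating_coefs_cochain g_co.
have eta_alt : alternating (primitive ann_wt (Lm 1) (Nm 0) (- (5%:R / 2%:R)) (coefs g)).
  by apply: alternating_contract_euler; apply: (alternating_weight ann_wt (fun x => x%:~R^-1)).
have [h h_co h_eta] := cochain_of_form char0 eta_alt (bounded_primitive (bounded_coefs g)).
exists h => // z; rewrite coefs_diff_sv // h_eta.
exact: (closed_balanced (@ann_wt_mul K) (@diagonal_L1 K) (@diagonal_N0 K) (ann_euler char0) char0).
Qed.

Lemma alternating_balanced_part n (w : form K Z n) :
  alternating w -> alternating (balanced_part ann_wt w).
Proof. exact: (alternating_weight ann_wt (fun x => (x == 0)%:R)). Qed.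

Lemma delta_balanced_part n (w : form K Z n) z :
  dl (balanced_part ann_wt w) z = balanced_part ann_wt (dl w) z.
Proof. exact: (delta_weight (@ann_wt_mul K) (fun x => (x == 0)%:R)). Qed.

Lemma closed_balanced_part n (g : precochain K 4 n) : g \in is_cocycle br (n := n) ->
  forall z, dl (balanced_part ann_wt (coefs g)) z = 0.
Proof.
move=> /asboolP [g_co /diff_eq0 g_closed] z.
by rewrite delta_balanced_part /balanced_part g_closed // mulr0.
Qed.

Definition ewedge l {n} : precochain K 4 n := wedge (tup l).

Lemma is_cochain_ewedge l n : is_cochain (ewedge l (n := n)).
Proof. exact: is_cochain_wedge. Qed.

Lemma coefs_ewedge l n z : size l = n ->
  coefs (ewedge l (n := n)) z = (\prod_(x <- l) x.2`!)%:R * edual K l z.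
Proof.
move=> l_n; rewrite coefs_wedge; congr (_%:R * _).
by rewrite -[in RHS](entries_tup l_n) big_tuple; apply: eq_bigr => k _; rewrite tnth_mktuple.
Qed.

Lemma is_coboundary_coefs n (g : precochain K 4 n.+1) (h : precochain K 4 n) :
    is_cochain g -> is_cochain h -> (forall z, coefs g z = coefs (diff br h) z) ->
  is_coboundary br g.
Proof.
move=> g_co h_co gh; exists h => //; apply: (coefs_inj char0) => //.
  exact: slotwise_of_cochain.
exact: slotwise_diff_sv.
Qed.

Lemma cocycle_cochain n (g : precochain K 4 n) : g \in is_cocycle br (n := n) -> is_cochain g.
Proof. by move=> /asboolP []. Qed.

Lemma is_coboundary1 (g : precochain K 4 1) : g \in is_cocycle br (n := 1) ->
  is_coboundary br g.
Proof.
move=> g_cy; have g_co := cocycle_cochain g_cy; have [h h_co gE] := cocycle_balanced g_cy.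
apply: (is_coboundary_coefs g_co h_co) => z; rewrite gE.
rewrite (closed_balanced1 char0) ?add0r //.
- exact: alternating_balanced_part (alternating_coefs_cochain g_co).
- exact: balanced_balanced_part.
- exact: closed_balanced_part.
Qed.

Lemma is_coboundary2 (g : precochain K 4 2) : g \in is_cocycle br (n := 2) ->
  is_coboundary br g.
Proof.
move=> g_cy; have g_co := cocycle_cochain g_cy; have [h h_co gE] := cocycle_balanced g_cy.
have [|||x [y E]] := closed_balanced2 char0 (w := balanced_part ann_wt (coefs g)).
- exact: alternating_balanced_part (alternating_coefs_cochain g_co).
- exact: balanced_balanced_part.
- exact: closed_balanced_part.
pose h' : precochain K 4 1 := x *: ewedge [:: Lm 1] + (y *: ewedge [:: Nm 0] + 0).
have h'_co : is_cochain h'.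
  by do 2 (apply: is_cochain_linear; first exact: is_cochain_ewedge); apply: is_cochain0.
apply: (is_coboundary_coefs (h := 1 *: h' + h)) => //; first exact: is_cochain_linear.
move=> z; rewrite gE E diff_linear coefs_linear mul1r; congr (_ + _).
rewrite coefs_diff_sv //; congr (dl _ z); apply: funext => z'.
by rewrite /h' !coefs_linear coefs0 !coefs_ewedge // unlock /= !mul1r addr0.
Qed.

Lemma is_coboundary_gt4 n (g : precochain K 4 n.+1) : (4 < n.+1)%N ->
  g \in is_cocycle br (n := n.+1) -> is_coboundary br g.
Proof.
move=> n4 g_cy; have g_co := cocycle_cochain g_cy; have [h h_co gE] := cocycle_balanced g_cy.
apply: (is_coboundary_coefs g_co h_co) => z; rewrite gE.
rewrite (balanced_gt4 char0) ?add0r //.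
- exact: alternating_balanced_part (alternating_coefs_cochain g_co).
- exact: balanced_balanced_part.
Qed.

(** Together with [L_2 L_0 N_0], whose class is a multiple of that of
    [L_1 L_0 N_1], these are the monomials of weight zero in degrees 3 and 4. *)
Definition Phi1 : precochain K 4 3 := ewedge [:: Lm 0; Nm 1; Nm 0].
Definition Phi2 : precochain K 4 3 := ewedge [:: Lm 1; Lm 0; Nm 1].
Definition Phi3 : precochain K 4 3 := ewedge [:: Lm 2; Lm 1; Lm 0].
Definition Psi1 : precochain K 4 4 := ewedge [:: Lm 1; Lm 0; Nm 1; Nm 0].
Definition Psi2 : precochain K 4 4 := ewedge [:: Lm 2; Lm 1; Lm 0; Nm 0].

Lemma is_cochain_Phi x y z : is_cochain (x *: Phi1 + (y *: Phi2 + (z *: Phi3 + 0))).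
Proof.
by do 3 (apply: is_cochain_linear; first exact: is_cochain_ewedge); apply: is_cochain0.
Qed.

Lemma is_cochain_Psi x y : is_cochain (x *: Psi1 + (y *: Psi2 + 0)).
Proof.
by do 2 (apply: is_cochain_linear; first exact: is_cochain_ewedge); apply: is_cochain0.
Qed.

Lemma coefs_Phi x y v z : coefs (x *: Phi1 + (y *: Phi2 + (v *: Phi3 + 0))) z =
  x * edual K [:: Lm 0; Nm 1; Nm 0] z + (y * edual K [:: Lm 1; Lm 0; Nm 1] z +
   (v * 2%:R) * edual K [:: Lm 2; Lm 1; Lm 0] z).
Proof. by rewrite !coefs_linear coefs0 !coefs_ewedge // unlock /= !mul1r addr0 mulrA. Qed.

Lemma coefs_Psi x y z : coefs (x *: Psi1 + (y *: Psi2 + 0)) z =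
  x * edual K [:: Lm 1; Lm 0; Nm 1; Nm 0] z +
   (y * 2%:R) * edual K [:: Lm 2; Lm 1; Lm 0; Nm 0] z.
Proof. by rewrite !coefs_linear coefs0 !coefs_ewedge // unlock /= !mul1r addr0 mulrA. Qed.

Lemma Phi_span (g : precochain K 4 3) : g \in is_cocycle br (n := 3) ->
  exists x y v, is_coboundary br (g - (x *: Phi1 + (y *: Phi2 + (v *: Phi3 + 0)))).
Proof.
move=> g_cy; have g_co := cocycle_cochain g_cy; have [h h_co gE] := cocycle_balanced g_cy.
have [||t [x [y [v E]]]] := balanced3 char0 (w := balanced_part ann_wt (coefs g)).
- exact: alternating_balanced_part (alternating_coefs_cochain g_co).
- exact: balanced_balanced_part.
exists x, y, (v / 2%:R).
have Phi_co := is_cochain_Phi x y (v / 2%:R).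
rewrite -scaleN1r addrC; apply: (is_coboundary_coefs (h := t *: ewedge [:: Lm 1; Nm 0] + h)).
- exact: is_cochain_linear.
- by apply: is_cochain_linear => //; apply: is_cochain_ewedge.
move=> z; rewrite coefs_linear coefs_Phi gE E diff_linear coefs_linear.
rewrite (coefs_diff_sv (is_cochain_ewedge [:: Lm 1; Nm 0] 2)).
rewrite divfK ?two_neq0 //; set d := dl (coefs _) z.
have -> : d = dl (edual K [:: Lm 1; Nm 0]) z; last by ring.
congr (dl _ z); apply: funext => z'; by rewrite coefs_ewedge // unlock /= mul1r.
Qed.

Lemma Phi_free x y v :
  is_coboundary br (x *: Phi1 + (y *: Phi2 + (v *: Phi3 + 0))) -> [/\ x = 0, y = 0 & v = 0].
Proof.
move=> [h h_co E]; have [||-> -> /eqP] :=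
  exact_balanced3 char0 (h := coefs h) (y := x) (u := y) (v := v * 2%:R).
- exact: alternating_coefs_cochain.
- by move=> z; rewrite -coefs_Phi E coefs_diff_sv.
by rewrite mulf_eq0 (negbTE (two_neq0 char0)) orbF => /eqP ->.
Qed.

Lemma Psi_span (g : precochain K 4 4) : g \in is_cocycle br (n := 4) ->
  exists x y, is_coboundary br (g - (x *: Psi1 + (y *: Psi2 + 0))).
Proof.
move=> g_cy; have g_co := cocycle_cochain g_cy; have [h h_co gE] := cocycle_balanced g_cy.
have [||x [y E]] := balanced4 char0 (w := balanced_part ann_wt (coefs g)).
- exact: alternating_balanced_part (alternating_coefs_cochain g_co).
- exact: balanced_balanced_part.
exists x, (y / 2%:R).
have Psi_co := is_cochain_Psi x (y / 2%:R).
rewrite -scaleN1r addrC; apply: (is_coboundary_coefs (h := h)) => //.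
  exact: is_cochain_linear.
move=> z; rewrite coefs_linear coefs_Psi gE E divfK ?two_neq0 //; ring.
Qed.

(** The weight zero part of a form of degree 3 is closed, so a coboundary of
    degree 4 has no weight zero part, whereas this combination has weight
    zero. *)
Lemma Psi_free x y : is_coboundary br (x *: Psi1 + (y *: Psi2 + 0)) -> x = 0 /\ y = 0.
Proof.
move=> [h h_co E].
have E0 z : weight ann_wt z == 0 -> coefs (x *: Psi1 + (y *: Psi2 + 0)) z = 0.
  move=> z0; rewrite E coefs_diff_sv //.
  have := closed_balanced3 char0
    (alternating_balanced_part (alternating_coefs_cochain h_co)) (balanced_balanced_part _) z.
  by rewrite delta_balanced_part /balanced_part z0 mul1r.
have w1 : weight ann_wt (tup [:: Lm 1; Lm 0; Nm 1; Nm 0] (n := 4)) == 0.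
  by rewrite /weight !big_ord_recl big_ord0.
have w2 : weight ann_wt (tup [:: Lm 2; Lm 1; Lm 0; Nm 0] (n := 4)) == 0.
  by rewrite /weight !big_ord_recl big_ord0.
move: (E0 _ w1) (E0 _ w2); rewrite !coefs_Psi !edual_tup //= !(mulr0, mulr1, addr0, add0r).
move=> x0 /eqP; rewrite mulf_eq0 (negbTE (two_neq0 char0)) orbF => /eqP y0.
by split.
Qed.
End SVCochains.

(** * The values of the cocycles *)

Section Values.
Variable K : fieldType.
Hypothesis char0 : [pchar K] =i pred0.
Notation Z := ('I_4 * nat)%type.

(** Natural number indices let the successive minors of a concrete matrix be
    evaluated by simplification. *)
Definition ndet (R : comNzRingType) n (f : nat -> nat -> R) : R :=
  \det (\matrix_(i < n, j < n) f i j).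

Lemma ndet0 (R : comNzRingType) f : ndet 0 f = 1 :> R.
Proof. exact: det_mx00. Qed.

Lemma ndetS (R : comNzRingType) n (f : nat -> nat -> R) :
  ndet n.+1 f =
  \sum_(j < n.+1) f 0%N j * ((-1) ^+ j * ndet n (fun i k => f i.+1 (bump j k))).
Proof.
rewrite /ndet (expand_det_row _ ord0); apply: eq_bigr => j _; rewrite mxE /cofactor add0n.
by congr (_ * (_ * \det _)); apply/matrixP => i k; rewrite !mxE lift0.
Qed.

Lemma ndet1 (R : comNzRingType) f : ndet 1 f = f 0%N 0%N :> R.
Proof. by rewrite ndetS big_ord_recl big_ord0 ndet0 /= expr0 addr0 !mulr1. Qed.

Lemma ndet2 (R : comNzRingType) f :
  ndet 2 f = f 0%N 0%N * f 1%N 1%N - f 0%N 1%N * f 1%N 0%N :> R.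
Proof. by rewrite ndetS !big_ord_recl big_ord0 !ndet1 /=; ring. Qed.

Lemma ndet3 (R : comNzRingType) f : ndet 3 f =
  f 0%N 0%N * (f 1%N 1%N * f 2%N 2%N - f 1%N 2%N * f 2%N 1%N) -
  f 0%N 1%N * (f 1%N 0%N * f 2%N 2%N - f 1%N 2%N * f 2%N 0%N) +
  f 0%N 2%N * (f 1%N 0%N * f 2%N 1%N - f 1%N 1%N * f 2%N 0%N) :> R.
Proof. by rewrite ndetS !big_ord_recl big_ord0 !ndet2 /=; ring. Qed.

Lemma ndet4 (R : comNzRingType) f :
  ndet 4 f = f 0%N 0%N * ndet 3 (fun i j => f i.+1 j.+1) -
   f 0%N 1%N * ndet 3 (fun i j => f i.+1 (bump 1 j)) +
   f 0%N 2%N * ndet 3 (fun i j => f i.+1 (bump 2 j)) -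
   f 0%N 3%N * ndet 3 (fun i j => f i.+1 (bump 3 j)) :> R.
Proof. by rewrite ndetS !big_ord_recl big_ord0 !ndet3 /=; ring. Qed.

(** The determinant is the value of the exterior product on its own
    generators. *)
Lemma determined_by_wedge n (l : seq Z) (t : n.+1.-tuple 'I_4) p :
    t = [seq x.1 | x <- l] :> seq _ ->
    ndet n.+1 (fun i j =>
      (nth gL t i == nth gL t j)%:R * lam i.+1 ^+ (nth (Lm 0) l j).2) = p ->
  determined_by (ewedge l : precochain K 4 n.+1) t p.
Proof.
move=> tl <-; have l_n : size l = n.+1 by rewrite -(size_tuple t) tl size_map.
split=> [|u].
  congr (\det _); apply/matrixP => i j; rewrite !mxE ffunE !mxE eqxx /= /lam /=.
  rewrite (_ : inord i = i); last by rewrite inord_val.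
  have -> : (tup l j).1 = nth gL t j by rewrite tl (nth_map (Lm 0)) ?l_n.
  rewrite (tnth_nth gL) eq_sym; congr (_ * _).
  by case: (_ == _); rewrite ?rmorph1 ?rmorph0.
apply: contraNeq => /eqP nz.
have [m] : exists m, coefs (ewedge l : precochain K 4 n.+1) (fun k => (tnth u k, m k)) != 0.
  apply: contrapT => /forallNP nm; apply: nz; apply: (taylor_inj char0) => m.
  rewrite taylor0; have /negP := nm m; rewrite negbK => /eqP <-.
  by congr (taylor (_ _) _).
rewrite coefs_ewedge // mulf_eq0 negb_or => /andP[_ /dual_perm_eq].
rewrite (entries_tup l_n) => /(perm_map fst); rewrite -tl -map_comp.
rewrite (_ : map _ _ = u) //; rewrite -[RHS](map_tnth_enum u).
by apply: eq_map => k.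
Qed.

Lemma determined_by_Phi1 :
  determined_by (@Phi1 K) [tuple gL; gN; gN] (lam 2 - lam 3).
Proof.
by apply: determined_by_wedge => //; rewrite ndet3 /=; ring.
Qed.

Lemma determined_by_Phi2 :
  determined_by (@Phi2 K) [tuple gL; gL; gN] ((lam 1 - lam 2) * lam 3).
Proof.
by apply: determined_by_wedge => //; rewrite ndet3 /=; ring.
Qed.

Lemma determined_by_Phi3 :
  determined_by (@Phi3 K) [tuple gL; gL; gL]
    ((lam 1 - lam 2) * (lam 1 - lam 3) * (lam 2 - lam 3)).
Proof.
by apply: determined_by_wedge => //; rewrite ndet3 /=; ring.
Qed.

Lemma determined_by_Psi1 :
  determined_by (@Psi1 K) [tuple gL; gL; gN; gN]
    ((lam 1 - lam 2) * (lam 3 - lam 4)).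
Proof.
by apply: determined_by_wedge => //; rewrite ndet4 !ndet3 /=; ring.
Qed.

Lemma determined_by_Psi2 :
  determined_by (@Psi2 K) [tuple gL; gL; gL; gN]
    ((lam 1 - lam 2) * (lam 1 - lam 3) * (lam 2 - lam 3)).
Proof.
by apply: determined_by_wedge => //; rewrite ndet4 !ndet3 /=; ring.
Qed.

End Values.

(** * Bases of the cohomology *)

Section SVCohomology.
Variable K : fieldType.
Hypothesis char0 : [pchar K] =i pred0.
Notation br := (@sv_bracket K).
Notation H q := (cohomology br q).

Lemma cohomology_basis0 : exists one : cocycle br 0,
  (forall a, sval one a = 1) /\ is_basis [tuple coh_class one].
Proof.
pose one : precochain K 4 0 := fun=> 1.
have one_cy : one \in is_cocycle br (n := 0).
  apply/asboolP; split=> //; split=> [a []|a []|s a] //.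
  have -> : s = 1%g by apply/permP; case.
  by rewrite odd_perm1 /one comp_mpoly1 mulr1.
exists (exist _ one one_cy); split=> //.
apply: (is_basis_coh_class (b := fun=> exist _ one one_cy)) => [i|g|c].
- by rewrite (ord1 i).
- exists (const_mx (val g [ffun k => 0])@_0%MM); rewrite big_ord1 mxE.
  apply: funext => a; apply: (etrans (y := val g a - (val g [ffun k => 0])@_0%MM *: 1)) => //.
  have -> : a = [ffun k => 0] by apply/ffunP => -[].
  apply/eqP; rewrite subr_eq0; apply/eqP/mpolyP => m.
  have -> : m = 0%MM by apply/mnmP => -[].
  by rewrite mcoeffZ mcoeff1 eqxx mulr1.
rewrite big_ord1 => /(congr1 (fun f : precochain K 4 0 => (f [ffun k => 0])@_0%MM)) E.
apply/rowP => i; rewrite (ord1 i) mxE.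
have : (c 0 0 *: (1 : {mpoly K[0]}))@_0%MM = (0 : {mpoly K[0]})@_0%MM := E.
by rewrite mcoeffZ mcoeff1 eqxx mulr1 mcoeff0.
Qed.

Lemma cohomology_eq0 q : q \notin [:: 0; 3; 4]%N -> forall x : H q, x = 0.
Proof.
move=> q034 x; have [g ->] := quot_classP x.
apply: (etrans _ (coh_class0 _ _)); apply/coh_class_eq.
have -> : val g - val (0 : cocycle br q) = val g by rewrite -[RHS]subr0; congr (_ - _);
  exact: linear0.
case: q q034 x g => [|[|[|[|[|q]]]]] // _ _ g.
- exact: is_coboundary1 char0 _ (valP g).
- exact: is_coboundary2 char0 _ (valP g).
by apply: (is_coboundary_gt4 char0) => //; apply: (valP g).
Qed.

Lemma cohomology_basis3 : exists P1 P2 P3 : cocycle br 3,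
  [/\ determined_by (sval P1) [tuple gL; gN; gN] (lam 2 - lam 3),
      determined_by (sval P2) [tuple gL; gL; gN] ((lam 1 - lam 2) * lam 3),
      determined_by (sval P3) [tuple gL; gL; gL]
        ((lam 1 - lam 2) * (lam 1 - lam 3) * (lam 2 - lam 3))
    & is_basis [tuple coh_class P1; coh_class P2; coh_class P3]].
Proof.
have cy l : size l = 3 -> \sum_(x <- l) ann_wt x = 0 -> ewedge l \in is_cocycle br (n := 3).
  move=> l3 l0; apply: (is_cocycle_balanced char0) => //; first exact: is_cochain_ewedge.
  by move=> z wz; rewrite coefs_ewedge // balanced_edual ?mulr0.
have cy1 : @Phi1 K \in is_cocycle br (n := 3) by apply: cy; rewrite // unlock.
have cy2 : @Phi2 K \in is_cocycle br (n := 3) by apply: cy; rewrite // unlock.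
have cy3 : @Phi3 K \in is_cocycle br (n := 3) by apply: cy; rewrite // unlock.
pose P1 : cocycle br 3 := exist _ (@Phi1 K) cy1;
  pose P2 : cocycle br 3 := exist _ (@Phi2 K) cy2.
pose P3 : cocycle br 3 := exist _ (@Phi3 K) cy3; exists P1, P2, P3; split.
- exact: determined_by_Phi1.
- exact: determined_by_Phi2.
- exact: determined_by_Phi3.
apply: (is_basis_coh_class (b := tnth [tuple P1; P2; P3])) => [i|g|c].
- by case: i => [[|[|[|//]]] ?]; rewrite !(tnth_nth (coh_class P1)) !(tnth_nth P1).
- have [x [y [v E]]] := Phi_span char0 (valP g).
  exists (\row_i [:: x; y; v]`_i); rewrite !big_ord_recl big_ord0 !mxE.
  exact: E.
rewrite !big_ord_recl big_ord0 => /(Phi_free char0) [x0 y0 v0].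
apply/rowP => i; rewrite mxE; case: i => [[|[|[|//]]] i3].
- by rewrite -[RHS]x0; congr (c 0 _); apply: val_inj.
- by rewrite -[RHS]y0; congr (c 0 _); apply: val_inj.
by rewrite -[RHS]v0; congr (c 0 _); apply: val_inj.
Qed.

Lemma cohomology_basis4 : exists P1 P2 : cocycle br 4,
  [/\ determined_by (sval P1) [tuple gL; gL; gN; gN] ((lam 1 - lam 2) * (lam 3 - lam 4)),
      determined_by (sval P2) [tuple gL; gL; gL; gN]
        ((lam 1 - lam 2) * (lam 1 - lam 3) * (lam 2 - lam 3))
    & is_basis [tuple coh_class P1; coh_class P2]].
Proof.
have cy l : size l = 4 -> \sum_(x <- l) ann_wt x = 0 -> ewedge l \in is_cocycle br (n := 4).
  move=> l4 l0; apply: (is_cocycle_balanced char0) => //; first exact: is_cochain_ewedge.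
  by move=> z wz; rewrite coefs_ewedge // balanced_edual ?mulr0.
have cy1 : @Psi1 K \in is_cocycle br (n := 4) by apply: cy; rewrite // unlock.
have cy2 : @Psi2 K \in is_cocycle br (n := 4) by apply: cy; rewrite // unlock.
pose P1 : cocycle br 4 := exist _ (@Psi1 K) cy1.
pose P2 : cocycle br 4 := exist _ (@Psi2 K) cy2; exists P1, P2; split.
- exact: determined_by_Psi1.
- exact: determined_by_Psi2.
apply: (is_basis_coh_class (b := tnth [tuple P1; P2])) => [i|g|c].
- by case: i => [[|[|//]] ?]; rewrite !(tnth_nth (coh_class P1)) !(tnth_nth P1).
- have [x [y E]] := Psi_span char0 (valP g).
  exists (\row_i [:: x; y]`_i); rewrite !big_ord_recl big_ord0 !mxE.
  exact: E.
rewrite !big_ord_recl big_ord0 => /(Psi_free char0) [x0 y0].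
apply/rowP => i; rewrite mxE; case: i => [[|[|//]] i2].
- by rewrite -[RHS]x0; congr (c 0 _); apply: val_inj.
by rewrite -[RHS]y0; congr (c 0 _); apply: val_inj.
Qed.

Lemma has_dim0 (V : lmodType K) : (forall x : V, x = 0) -> has_dim V 0.
Proof.
move=> V0; exists [tuple] => v; exists 0; split=> [|c _]; first by rewrite big_ord0; apply: V0.
by rewrite (thinmx0 c).
Qed.

Lemma has_dim_cohomology q : has_dim (H q)
  (if q == 0 then 1 else if q == 3 then 3 else if q == 4 then 2 else 0)%N.
Proof.
have [->|q0] := eqVneq q 0%N.
  by have [one [_ B]] := cohomology_basis0; exists [tuple coh_class one].
have [->|q3] := eqVneq q 3.
  by have [P1 [P2 [P3 [_ _ _ B]]]] := cohomology_basis3;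
    exists [tuple coh_class P1; coh_class P2; coh_class P3].
have [->|q4] := eqVneq q 4.
  by have [P1 [P2 [_ _ B]]] := cohomology_basis4; exists [tuple coh_class P1; coh_class P2].
by apply/has_dim0/cohomology_eq0; rewrite !inE !negb_or q0 q3.
Qed.
End SVCohomology.

Theorem theorem3p12 (R : realType) :
  let C : fieldType := R[i] in
  let br := @sv_bracket C in
  let H q := cohomology br q in
  (forall q : nat,
     has_dim (H q) (if q == 0 then 1 else if q == 3 then 3
                    else if q == 4 then 2 else 0)%N) /\
  [/\ exists one : cocycle br 0,
        (forall a, sval one a = 1) /\ is_basis [tuple coh_class one],
      exists Phi1 Phi2 Phi3 : cocycle br 3,
        [/\ determined_by (sval Phi1) [tuple gL; gN; gN] (lam 2 - lam 3),
            determined_by (sval Phi2) [tuple gL; gL; gN] ((lam 1 - lam 2) * lam 3),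
            determined_by (sval Phi3) [tuple gL; gL; gL]
              ((lam 1 - lam 2) * (lam 1 - lam 3) * (lam 2 - lam 3))
          & is_basis [tuple coh_class Phi1; coh_class Phi2; coh_class Phi3]],
      exists Psi1 Psi2 : cocycle br 4,
        [/\ determined_by (sval Psi1) [tuple gL; gL; gN; gN]
              ((lam 1 - lam 2) * (lam 3 - lam 4)),
            determined_by (sval Psi2) [tuple gL; gL; gL; gN]
              ((lam 1 - lam 2) * (lam 1 - lam 3) * (lam 2 - lam 3))
          & is_basis [tuple coh_class Psi1; coh_class Psi2]]
    & forall q : nat, q \notin [:: 0; 3; 4]%N -> forall x : H q, x = 0].
Proof.
have char0 : [pchar R[i]] =i pred0 by exact: Num.Theory.pchar_num.
split; first exact: has_dim_cohomology char0.
split.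
- exact: cohomology_basis0.
- exact: cohomology_basis3 char0.
- exact: cohomology_basis4 char0.
- exact: cohomology_eq0 char0.
Qed.
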